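(* Let $T$ be a theory in a language with a family $(R_i)_{i\in I}$ of binary relation symbols and a family $(f_h)_{h\in H}$ of unary function symbols, such that $T$ asserts that every $R_i$ is transitive, and such that every other axiom of $T$ is one of the following (each kind may occur for any number of indices, possibly none): (1) $R_i$ is reflexive; (2) $R_i$ is symmetric; (3) $R_i$ is antireflexive; (4) $R_i$ is antisymmetric; (5) $f_h$ preserves $R_i$ ($xR_iy\Rightarrow f_h(x)R_if_h(y)$); (6) $f_h$ is $R_i$-reversing ($xR_iy\Rightarrow f_h(y)R_if_h(x)$); (7) $R_i$ is coarser than $R_j$ ($R_j\subseteq R_i$); (8) any sentence of the form $\forall x\exists y_1y_2\dots\varphi$, $\forall x\varphi$ or $\exists y_1y_2\dots\varphi$ with $\varphi$ quantifier-free (for example the universal closures of $f_h(x)R_if_h(x)$, $xR_if_h(x)$, $f_h(f_h(x))=f_h(x)$, $f_h(f_k(x))=f_k(f_h(x))$); (9) $f_h$ strictly preserves $R_i$ ($xR_iy$ and $x\neq y$ imply $f_h(x)R_if_h(y)$ and $f_h(x)\neq f_h(y)$), provided $T$ asserts that $R_i$ is a partial order; (10) $f_h$ is strictly $R_i$-reversing ($xR_iy$ and $x\neq y$ imply $f_h(y)R_if_h(x)$ and $f_h(x)\neq f_h(y)$), provided $T$ asserts that $R_i$ is a partial order. Then the class $\mathcal K$ of models of $T$ has SAPU, and in fact superSAPU with respect to every $R_i$. The same holds for the models of $T\cup\Sigma'$ in any expansion of the language by arbitrary further symbols, where $\Sigma'$ is a set of sentences of the forms in (8). Furthermore, for each such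 class $\mathcal K$, the subclass of structures satisfying any given set of the following conditions has SAPU: the domain is finite (or of cardinality $<\lambda$, $\lambda$ an infinite cardinal); the structure is finitely generated (or generated by fewer than $\lambda$ elements); a given relation that is a partial order in all members of $\mathcal K$ is well-founded (or has no strictly descending, resp. ascending, chain of length $\geq\lambda$); for a given binary relation there is no infinite antichain (or none of cardinality $\geq\lambda$); the domain has cardinality $kn+m$ for some $k$, for fixed naturals $n,m$; and — for the version of SAPU in which the bottom structure $\mathbf C$ is nonempty — the structure is connected (or $R$-connected, or $\mathcal R$-connected); as well as any of these conditions imposed on the subset $\{x\mid V(x)\}$ for a unary predicate $V$.
   Context: Embeddings are injective maps preserving functions and constants and preserving and reflecting relations; $\mathbf A\subseteq\mathbf B$ means $A\subseteq B$ and inclusion is an embedding; classes are closed under isomorphism. SAPU: whenever $\mathbf A,\mathbf B,\mathbf C\in\mathcal K$, $\mathbf C\subseteq\mathbf A$, $\mathbf C\subseteq\mathbf B$, $C=A\cap B$, there is $\mathbf D\in\mathcal K$ with $\mathbf A,\mathbf B\subseteq\mathbf D$ and $D=A\cup B$. superSAPU with respect to $R$: moreover $\mathbf D$ can be chosen so that for $a\in A\setminus B$, $b\in B\setminus A$, $aR^{\mathbf D}b$ implies $aR^{\mathbf A}cR^{\mathbf B}b$ for some $c\in C$, and $bR^{\mathbf D}a$ implies $bR^{\mathbf B}cR^{\mathbf A}a$ for some $c\in C$. An antichain for $R$ is a set no two distinct elements of which are $R$-related. Elements $a,b$ are $R$-adjacent if $R(a_1,\dots)$ holds for a tuple containing $a$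 in some position $m$ and $b$ in some position $n$ (an $R$-$m$-$n$-directed edge from $a$ to $b$); functions $f$ are treated as relations $f(a_1,\dots,a_n)=a_{n+1}$; adjacent means $R$-adjacent for some $R$. A structure is connected (resp. $R$-connected) if any two elements are joined by a finite path of consecutively adjacent (resp. $R$-adjacent) elements; for a family $\mathcal R$ of triples $(R,m,n)$ it is $\mathcal R$-connected if any $a,b$ are joined by a sequence $a=a_1,\dots,a_h=b$ with, for each $i<h$, an $R$-$m$-$n$-directed edge from $a_i$ to $a_{i+1}$ for some $(R,m,n)\in\mathcal R$.
   Formalization: For connectedness (or R-, 𝓡-connectedness) imposed on the subset {x | V(x)}, the bottom structure C is required to contain an element satisfying V, not merely to be nonempty; with only C nonempty the claim fails. *)

(* Defs.v *)
From HB Require Import structures.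
From Stdlib Require Export Relation_Operators.
From mathcomp Require Export all_boot.
From mathcomp Require Export boolp classical_sets functions cardinality wochoice.

Set Implicit Arguments.
Unset Strict Implicit.
Unset Printing Implicit Defensive.

Local Open Scope classical_set_scope.
Local Open Scope card_scope.

(* Constants are the function symbols of arity 0. *)
Record language := Language {
  fsym : Type;
  farity : fsym -> nat;
  rsym : Type;
  rarity : rsym -> nat
}.

(* Domains may be empty (when the language has no constant). *)
Record structure (L : language) (X : Type) := Structure {
  fint : forall f : fsym L, ('I_(farity f) -> X) -> X;
  rint : forall r : rsym L, ('I_(rarity r) -> X) -> Prop
}.

(* A formula in [formula L n] has its free variables among n variables; under a
   quantifier, the variable [ord0] is the bound one and the others are shifted,
   so sentences make sense in empty domains too. *)
Inductive term (L : language) (n : nat) :=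
| Var (i : 'I_n)
| App (f : fsym L) (t : 'I_(farity f) -> term L n).

Inductive formula (L : language) (n : nat) :=
| Eq (s t : term L n)
| Rel (r : rsym L) (t : 'I_(rarity r) -> term L n)
| Not (p : formula L n)
| And (p q : formula L n)
| Or (p q : formula L n)
| Imp (p q : formula L n)
| All (p : formula L n.+1)
| Ex (p : formula L n.+1).

Arguments Var {L n} & i.
Arguments App {L n} f t.
Arguments Eq {L n} & s t.
Arguments Rel {L n} r t.
Arguments Not {L n} & p.
Arguments And {L n} & p q.
Arguments Or {L n} & p q.
Arguments Imp {L n} & p q.
Arguments All {L n} & p.
Arguments Ex {L n} & p.

Fixpoint quantifier_free L n (p : formula L n) : bool :=
  match p with
  | Eq _ _ | Rel _ _ => true
  | Not p => quantifier_free p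
  | And p q | Or p q | Imp p q => quantifier_free p && quantifier_free q
  | All _ | Ex _ => false
  end.

Fixpoint exists_block L k n : formula L (k + n) -> formula L n :=
  match k with
  | 0 => fun p => p
  | k'.+1 => fun p => @exists_block L k' n (Ex p)
  end.

Section Satisfaction.
Variables (L : language) (X : Type) (M : structure L X).

Fixpoint eval n (v : 'I_n -> X) (t : term L n) : X :=
  match t with
  | Var i => v i
  | App f ts => fint M (fun j : 'I_(farity f) => eval v (ts j))
  end.

Definition vcons n (x : X) (v : 'I_n -> X) : 'I_n.+1 -> X :=
  fun i => oapp v x (unlift ord0 i).

Fixpoint sat n (p : formula L n) : ('I_n -> X) -> Prop :=
  match p with
  | Eq s t => fun v => eval v s = eval v t
  | Rel r ts => fun v => rint M (fun j : 'I_(rarity r) => eval v (ts j))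
  | Not p => fun v => ~ sat p v
  | And p q => fun v => sat p v /\ sat q v
  | Or p q => fun v => sat p v \/ sat q v
  | Imp p q => fun v => sat p v -> sat q v
  | All p => fun v => forall x, sat p (vcons x v)
  | Ex p => fun v => exists x, sat p (vcons x v)
  end.

Definition no_var : 'I_0 -> X := fun i => False_rect X (notF (ltn_ord i)).

Definition models (p : formula L 0) : Prop := sat p no_var.

End Satisfaction.

Definition theory (L : language) := set (formula L 0).

Definition class (L : language) := forall X : Type, structure L X -> Prop.

Definition Mod L (T : theory L) : class L :=
  fun X M => forall p, T p -> models M p.

Definition asserts L (T : theory L) (p : formula L 0) : Prop :=
  forall (X : Type) (M : structure L X), Mod T M -> models M p.

Definition embedding L X Y (M : structure L X) (N : structure L Y)
    (e : X -> Y) : Prop :=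
  [/\ injective e,
      forall (f : fsym L) t, e (fint M t) = fint N (fun i : 'I_(farity f) => e (t i))
    & forall (r : rsym L) t, rint M t <-> rint N (fun i : 'I_(rarity r) => e (t i))].

(* Structures whose domain is a subset of an ambient type U, so that inclusions,
   unions and intersections of domains are meant literally. *)
Record structure_in (L : language) (U : Type) := StructureIn {
  dom : set U;
  str :> structure L dom
}.

Definition mem_class L U (K : class L) (A : structure_in L U) : Prop :=
  @K (dom A) (str A).

Definition substructure L U (C A : structure_in L U) : Prop :=
  exists j : dom C -> dom A,
    (forall x, set_val (j x) = set_val x) /\ embedding C A j.

Definition amalgam L U (A B D : structure_in L U) : Prop :=
  [/\ substructure A D, substructure B D & dom D = dom A `|` dom B].

(* [bottom C] restricts the bottom structures that have to be considered. *)
Definition SAPU_over L (bottom : class L) (K : class L) : Prop :=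
  forall (U : Type) (A B C : structure_in L U),
    mem_class K A -> mem_class K B -> mem_class K C ->
    substructure C A -> substructure C B -> dom C = dom A `&` dom B ->
    mem_class bottom C ->
    exists D : structure_in L U, mem_class K D /\ amalgam A B D.

Definition SAPU L (K : class L) : Prop := SAPU_over (fun _ _ => True) K.

Definition pair_args n T (x y : T) : 'I_n -> T :=
  fun j => if nat_of_ord j == 0 then x else y.

(* Only meant for symbols r of arity 2. *)
Definition bin L X (M : structure L X) (r : rsym L) (x y : X) : Prop :=
  rint M (pair_args (n := rarity r) x y).

(* x r^A y, for elements x, y of the ambient type. *)
Definition related L U (A : structure_in L U) (r : rsym L) (x y : U) : Prop :=
  exists a b : dom A, [/\ set_val a = x, set_val b = y & bin A r a b].

Definition superSAPU L (K : class L) (r : rsym L) : Prop :=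
  forall (U : Type) (A B C : structure_in L U),
    mem_class K A -> mem_class K B -> mem_class K C ->
    substructure C A -> substructure C B -> dom C = dom A `&` dom B ->
    exists D : structure_in L U,
      [/\ mem_class K D, amalgam A B D
        & forall a b : U, (dom A `\` dom B) a -> (dom B `\` dom A) b ->
            (related D r a b ->
               exists c, [/\ dom C c, related A r a c & related B r c b]) /\
            (related D r b a ->
               exists c, [/\ dom C c, related B r b c & related A r c a])].

Definition base_language (I H : Type) : language :=
  @Language H (fun=> 1) I (fun=> 2).

Section Sentences.
Variables I H : Type.
Notation L := (base_language I H).

Definition R_ n (i : I) (s t : term L n) : formula L n :=
  @Rel L n i (pair_args s t).

Definition f_ n (h : H) (t : term L n) : term L n := @App L n h (fun=> t).

Definition x_ n k (lt_k_n : k < n) : term L n := Var (Ordinal lt_k_n).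

Local Arguments x_ {n} & k lt_k_n.
Local Arguments R_ {n} & i s t.
Local Arguments f_ {n} & h t.

(* De Bruijn variables: in a closed formula starting with two (three)
   quantifiers, the first quantified variable is 'x_1 ('x_2). *)
Local Notation "''x_' k" := (x_ k isT) (at level 8, k at level 2).

Definition ax_transitive i : formula L 0 :=
  All (All (All (Imp (And (R_ i 'x_2 'x_1) (R_ i 'x_1 'x_0)) (R_ i 'x_2 'x_0)))).

Definition ax_reflexive i : formula L 0 := All (R_ i 'x_0 'x_0).

Definition ax_symmetric i : formula L 0 :=
  All (All (Imp (R_ i 'x_1 'x_0) (R_ i 'x_0 'x_1))).

Definition ax_antireflexive i : formula L 0 := All (Not (R_ i 'x_0 'x_0)).

Definition ax_antisymmetric i : formula L 0 :=
  All (All (Imp (And (R_ i 'x_1 'x_0) (R_ i 'x_0 'x_1)) (Eq 'x_1 'x_0))).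

Definition ax_preserves h i : formula L 0 :=
  All (All (Imp (R_ i 'x_1 'x_0) (R_ i (f_ h 'x_1) (f_ h 'x_0)))).

Definition ax_reverses h i : formula L 0 :=
  All (All (Imp (R_ i 'x_1 'x_0) (R_ i (f_ h 'x_0) (f_ h 'x_1)))).

Definition ax_coarser i j : formula L 0 :=
  All (All (Imp (R_ j 'x_1 'x_0) (R_ i 'x_1 'x_0))).

Definition ax_strictly_preserves h i : formula L 0 :=
  All (All (Imp (And (R_ i 'x_1 'x_0) (Not (Eq 'x_1 'x_0)))
    (And (R_ i (f_ h 'x_1) (f_ h 'x_0)) (Not (Eq (f_ h 'x_1) (f_ h 'x_0)))))).

Definition ax_strictly_reverses h i : formula L 0 :=
  All (All (Imp (And (R_ i 'x_1 'x_0) (Not (Eq 'x_1 'x_0)))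
    (And (R_ i (f_ h 'x_0) (f_ h 'x_1)) (Not (Eq (f_ h 'x_1) (f_ h 'x_0)))))).

Definition asserts_partial_order (T : theory L) (i : I) : Prop :=
  [/\ asserts T (ax_reflexive i), asserts T (ax_transitive i)
    & asserts T (ax_antisymmetric i)].

End Sentences.

Inductive simple_sentence (L : language) : formula L 0 -> Prop :=
| SimpleAE k (p : formula L (k.+1 + 1)) :
    quantifier_free p -> simple_sentence (All (exists_block p))
| SimpleA (p : formula L 1) :
    quantifier_free p -> simple_sentence (All p)
| SimpleE k (p : formula L (k.+1 + 0)) :
    quantifier_free p -> simple_sentence (exists_block p).

Inductive admissible_axiom (I H : Type) (T : theory (base_language I H)) :
    formula (base_language I H) 0 -> Prop :=
| AxTransitive i : admissible_axiom T (ax_transitive H i)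
| AxReflexive i : admissible_axiom T (ax_reflexive H i)
| AxSymmetric i : admissible_axiom T (ax_symmetric H i)
| AxAntireflexive i : admissible_axiom T (ax_antireflexive H i)
| AxAntisymmetric i : admissible_axiom T (ax_antisymmetric H i)
| AxPreserves h i : admissible_axiom T (ax_preserves h i)
| AxReverses h i : admissible_axiom T (ax_reverses h i)
| AxCoarser i j : admissible_axiom T (ax_coarser H i j)
| AxSimple p : simple_sentence p -> admissible_axiom T p
| AxStrictlyPreserves h i : asserts_partial_order T i ->
    admissible_axiom T (ax_strictly_preserves h i)
| AxStrictlyReverses h i : asserts_partial_order T i ->
    admissible_axiom T (ax_strictly_reverses h i).

Definition admissible_theory (I H : Type) (T : theory (base_language I H)) :=
  (forall i, asserts T (ax_transitive H i)) /\
  (forall p, T p -> admissible_axiom T p).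

Definition expansion (L E : language) : language :=
  @Language (fsym L + fsym E)%type
    (fun f => match f with inl f => farity f | inr f => farity f end)
    (rsym L + rsym E)%type
    (fun r => match r with inl r => rarity r | inr r => rarity r end).

Section Expansion.
Variables L E : language.
Notation LE := (expansion L E).

Fixpoint lift_term n (t : term L n) : term LE n :=
  match t with
  | Var i => Var i
  | App f ts => @App LE n (inl f) (fun j => lift_term (ts j))
  end.

Fixpoint lift_formula n (p : formula L n) : formula LE n :=
  match p with
  | Eq s t => Eq (lift_term s) (lift_term t)
  | Rel r ts => @Rel LE n (inl r) (fun j => lift_term (ts j))
  | Not p => Not (lift_formula p)
  | And p q => And (lift_formula p) (lift_formula q)
  | Or p q => Or (lift_formula p) (lift_formula q)
  | Imp p q => Imp (lift_formula p) (lift_formula q)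
  | All p => All (lift_formula p)
  | Ex p => Ex (lift_formula p)
  end.

Definition lift_theory (T : theory L) : theory LE := @lift_formula 0 @` T.

End Expansion.

Arguments lift_theory {L} E T.

(* Function symbols are treated as relations, the value being the last entry. *)
Definition symbol (L : language) : Type := (fsym L + rsym L)%type.

Definition sarity L (s : symbol L) : nat :=
  match s with inl f => (farity f).+1 | inr r => rarity r end.

Definition sint L X (M : structure L X) (s : symbol L) :
    ('I_(sarity s) -> X) -> Prop :=
  match s with
  | inl f => fun t =>
      fint M (fun j : 'I_(farity f) => t (widen_ord (leqnSn (farity f)) j)) =
      t ord_max
  | inr r => fun t => rint M t
  end.

Record edge_kind (L : language) := EdgeKind {
  edge_sym : symbol L;
  edge_src : 'I_(sarity edge_sym);
  edge_tgt : 'I_(sarity edge_sym)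
}.

Definition directed_edge L X (M : structure L X) (k : edge_kind L) (a b : X) :=
  exists t, [/\ sint M t, t (edge_src k) = a & t (edge_tgt k) = b].

Definition adjacent_by L X (M : structure L X) (s : symbol L) (a b : X) : Prop :=
  exists m n : 'I_(sarity s), directed_edge M (EdgeKind m n) a b.

Definition adjacent L X (M : structure L X) (a b : X) : Prop :=
  exists s, adjacent_by M s a b.

Definition joined_in X (P : set X) (E : X -> X -> Prop) : Prop :=
  forall a b, P a -> P b ->
    clos_refl_trans X (fun x y => [/\ P x, P y & E x y]) a b.

(* A cardinal lambda is given by a type of that cardinality. *)
Definition card_lt X (P : set X) (lam : Type) : Prop :=
  P #<= [set: lam] /\ ~~ ([set: lam] #<= P).

Definition card_ge X (P : set X) (lam : Type) : Prop := [set: lam] #<= P.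

Definition closed_under_functions L X (M : structure L X) (S : set X) : Prop :=
  forall (f : fsym L) (t : 'I_(farity f) -> X), (forall i, S (t i)) -> S (fint M t).

Definition generates L X (M : structure L X) (G P : set X) : Prop :=
  smallest (closed_under_functions M) G = P.

Definition is_partial_order X (R : X -> X -> Prop) : Prop :=
  [/\ forall x, R x x, forall x y z, R x y -> R y z -> R x z
    & forall x y, R x y -> R y x -> x = y].

Definition strict X (R : X -> X -> Prop) (x y : X) : Prop := R x y /\ x <> y.

(* A chain whose length is the ordinal of the well-order W; as lambda is a
   cardinal, this ordinal is >= lambda iff W has at least lambda elements. *)
Definition increasing_chain X (P : set X) (R : X -> X -> Prop) (lam : Type) :=
  exists (W : Type) (le : rel W) (s : W -> X),
    [/\ well_order le, card_ge [set: W] lam, forall w, P (s w)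
      & forall w w', le w w' -> w <> w' -> strict R (s w) (s w')].

Definition decreasing_chain X (P : set X) (R : X -> X -> Prop) (lam : Type) :=
  increasing_chain P (fun x y => R y x) lam.

Definition antichain X (R : X -> X -> Prop) (Y : set X) : Prop :=
  forall x y, Y x -> Y y -> x <> y -> ~ R x y.

Inductive basic_condition (L : language) :=
| Finite
| CardLt (lam : Type)
| FinitelyGenerated
| GeneratedByLt (lam : Type)
| WellFounded (r : rsym L)
| NoDescendingChain (r : rsym L) (lam : Type)
| NoAscendingChain (r : rsym L) (lam : Type)
| NoInfiniteAntichain (r : rsym L)
| NoAntichain (r : rsym L) (lam : Type)
| CardMod (n m : nat)
| Connected
| SymConnected (s : symbol L)
| FamilyConnected (Rs : set (edge_kind L)).

Arguments Finite {L}.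
Arguments CardLt {L} lam.
Arguments FinitelyGenerated {L}.
Arguments GeneratedByLt {L} lam.
Arguments CardMod {L} n m.
Arguments Connected {L}.

(* The condition c imposed on the subset P of the domain. *)
Definition holds_on L X (M : structure L X) (P : set X)
    (c : basic_condition L) : Prop :=
  match c with
  | Finite => finite_set P
  | CardLt lam => card_lt P lam
  | FinitelyGenerated => exists G, finite_set G /\ generates M G P
  | GeneratedByLt lam => exists G, card_lt G lam /\ generates M G P
  | WellFounded r =>
      well_founded (fun x y => [/\ P x, P y & strict (bin M r) x y])
  | NoDescendingChain r lam => ~ decreasing_chain P (bin M r) lam
  | NoAscendingChain r lam => ~ increasing_chain P (bin M r) lam
  | NoInfiniteAntichain r =>
      ~ exists Y, [/\ Y `<=` P, antichain (bin M r) Y & infinite_set Y]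
  | NoAntichain r lam =>
      ~ exists Y, [/\ Y `<=` P, antichain (bin M r) Y & card_ge Y lam]
  | CardMod n m => exists k, P #= `I_(k * n + m)
  | Connected => joined_in P (adjacent M)
  | SymConnected s => joined_in P (adjacent_by M s)
  | FamilyConnected Rs =>
      joined_in P (fun a b => exists2 k, Rs k & directed_edge M k a b)
  end.

Definition legitimate_basic L (K : class L) (c : basic_condition L) : Prop :=
  let infinite lam := infinite_set [set: lam] in
  let binary r := rarity r = 2 in
  let partial_order_in_K r :=
    binary r /\
    forall X (M : structure L X), K X M -> is_partial_order (bin M r) in
  match c with
  | CardLt lam | GeneratedByLt lam => infinite lam
  | WellFounded r => partial_order_in_K r
  | NoDescendingChain r lam | NoAscendingChain r lam =>
      partial_order_in_K r /\ infinite lam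
  | NoInfiniteAntichain r => binary r
  | NoAntichain r lam => binary r /\ infinite lam
  | Finite | FinitelyGenerated | CardMod _ _ | Connected | SymConnected _
  | FamilyConnected _ => True
  end.

Definition is_connectedness L (c : basic_condition L) : bool :=
  match c with
  | Connected | SymConnected _ | FamilyConnected _ => true
  | _ => false
  end.

(* A condition is imposed either on the whole domain or on {x | V(x)}. *)
Inductive condition (L : language) :=
| OnDomain (c : basic_condition L)
| OnPredicate (V : rsym L) (c : basic_condition L).

Definition extent L X (M : structure L X) (V : rsym L) : set X :=
  [set x | rint M (fun _ : 'I_(rarity V) => x)].

Definition satisfies L X (M : structure L X) (c : condition L) : Prop :=
  match c with
  | OnDomain c => holds_on M setT c
  | OnPredicate V c => holds_on M (extent M V) c
  end.

Definition legitimate L (K : class L) (c : condition L) : Prop :=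
  match c with
  | OnDomain c => legitimate_basic K c
  | OnPredicate V c => rarity V = 1 /\ legitimate_basic K c
  end.

Definition subclass L (K : class L) (S : set (condition L)) : class L :=
  fun X M => K X M /\ forall c, S c -> satisfies M c.

(* Connectedness is only preserved when the bottom structure is nonempty; for
   connectedness of {x | V(x)}, this set has to be nonempty in the bottom
   structure. *)
Definition allowed_bottom L (S : set (condition L)) : class L :=
  fun X M => forall c, S c ->
    match c with
    | OnDomain c => is_connectedness c -> [set: X] !=set0
    | OnPredicate V c => is_connectedness c -> extent M V !=set0
    end.

Definition subclasses_SAPU L (K : class L) : Prop :=
  forall S : set (condition L), (forall c, S c -> legitimate K c) ->
    SAPU_over (allowed_bottom S) (subclass K S).

(* Main.v *)
From mathcomp Require finmap.
Require Import Defs.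

(* Each R_i is extended to the union D of A and B by the composites a R^A c R^B b
   and b R^B c R^A a. As R_i is transitive, in a longer composite every step that
   begins and ends in C is already a step inside A and inside B, so this extension
   is transitive and restricts to R_i on A and on B; superSAPU holds by
   construction. All other relations are united, and a function at arguments
   that lie neither in A nor in B returns one of these arguments. Every axiom of T
   then passes from A and B to D: a simple sentence quantifies universally over
   at most one element, which lies in A or in B. *)

Set Implicit Arguments.
Unset Strict Implicit.
Unset Printing Implicit Defensive.
Local Open Scope classical_set_scope.
Local Open Scope card_scope.

(** * Cardinal arithmetic *)

(** The strict axioms are the delicate ones. In a composite a R c R b of three distinct points, f(a)
    differs from f(c) and f(c) from f(b), but transitivity alone does not exclude f(a) = f(b).
    Antisymmetry does, since otherwise f(a) and f(c) would be related both ways. Hence the strict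
    part of a glued partial order is built from the two strict parts by the same formula as the
    order itself, and axioms (9) and (10) become plain monotonicity statements about strict parts.
    That formula is monotone in both relations, which settles inclusions between relations, and it
    commutes with unary maps, since these act inside A and inside B. The side conditions rest on the
    fact that a set covered by two pieces is large only if one piece is. As cardinals are given by
    types, this is derived from Zorn's lemma through comparability and the absorption of doubling. C
    contributes its cardinality to the count modulo n, by inclusion-exclusion, and a base point
    through which paths in A and in B are connected. *)

Lemma card_le_relP T U (A : set T) (B : set U) :
  (A #<= B) <-> exists R : T -> U -> Prop,
    (forall x, A x -> exists2 y, B y & R x y) /\
    (forall x x' y, A x -> A x' -> R x y -> R x' y -> x = x').
Proof.
split=> [/card_leP[f]|[R [Rtot Rinj]]].
  exists (fun x y => exists a : A, set_val a = x /\ set_val (f a) = y); split.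
    move=> x Ax; exists (set_val (f (SigSub (mem_set Ax)))).
      exact: set_valP.
    by exists (SigSub (mem_set Ax)).
  move=> x x' y _ _ [a [<- <-]] [a' [<- /val_inj e]].
  by congr set_val; apply/esym; apply: (@inj _ _ setT f) e; rewrite inE.
have /choice[f fP] : forall a : A, exists b : B, R (set_val a) (set_val b).
  move=> a; have [y By Ry] := Rtot _ (set_valP a).
  by exists (SigSub (mem_set By)).
apply/card_leP/injfunPex; exists f => // a a' _ _ e.
apply: val_inj; apply: Rinj (set_valP a) (set_valP a') (fP a) _.
by rewrite e; exact: fP.
Qed.

(** Serves Zorn's lemma: a property of pairs of elements passes to the union of a chain, because
    both elements already lie in one member. *)
Lemma chain_upper2 T (F : set (set T)) (x y : T) (X Y : set T) :
  total_on F subset -> F X -> F Y -> X x -> Y y ->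
  exists2 Z, F Z & Z x /\ Z y.
Proof.
move=> Ftot FX FY Xx Yy.
by have [XY|YX] := Ftot _ _ FX FY; [exists Y|exists X] => //; split=> //;
  [exact: XY|exact: YX].
Qed.

(** Zorn gives a maximal graph [G] of a partial injection from [A] to [B]. If some [a] and some [b]
    were both unmatched, the pair [(a, b)] could be added; so [G] or its converse is total. *)
Lemma card_le_total T U (A : set T) (B : set U) : A #<= B \/ B #<= A.
Proof.
pose P (G : set (T * U)) := (forall p, G p -> A p.1 /\ B p.2) /\
  (forall p q, G p -> G q -> (p.1 = q.1 <-> p.2 = q.2)).
have [F FP Ftot|G [[GAB Ginj] Gmax]] := @Zorn_bigcup _ P.
  split=> [p [X FX Xp]|p q [X FX Xp] [Y FY Yq]]; first exact: (FP _ FX).1.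
  have [Z FZ [Zp Zq]] := chain_upper2 Ftot FX FY Xp Yq.
  exact: (FP _ FZ).2.
have [Gtot|/existsNP[a /not_implyP[Aa aN]]] :=
    pselect (forall a, A a -> exists b, G (a, b)).
  left; apply/card_le_relP; exists (fun a b => G (a, b)); split=> [a Aa|].
    by have [b Gab] := Gtot a Aa; exists b => //; exact: (GAB _ Gab).2.
  by move=> a a' b _ _ Gab Ga'b; exact/(Ginj _ _ Gab Ga'b).
have [Gsur|/existsNP[b /not_implyP[Bb bN]]] :=
    pselect (forall b, B b -> exists a, G (a, b)).
  right; apply/card_le_relP; exists (fun b a => G (a, b)); split=> [b Bb|].
    by have [a' Gab] := Gsur b Bb; exists a' => //; exact: (GAB _ Gab).1.
  by move=> b b' a' _ _ Gab Gab'; exact/(Ginj _ _ Gab Gab').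
have [] := Gmax (G `|` [set (a, b)]).
  split=> [p|/(_ (a, b) (or_intror erefl)) Gab]; first by left.
  by apply: aN; exists b.
split=> [p [/GAB //|-> //]|[x y] [x' y'] [Gp|[-> ->]] [Gq|[-> ->]]] //=.
- exact: (Ginj _ _ Gp Gq).
- by split=> e; [case: aN; exists y|case: bN; exists x]; rewrite -e.
- by split=> e; [case: aN; exists y'|case: bN; exists x']; rewrite e.
Qed.

(* Zorn gives a maximal injection D x bool -> D with D a subset of T. The complement
   of D is finite: a sequence g in it would allow the extension
   (g n, b) |-> g (2n + b). *)
Lemma card_le_double T : infinite_set [set: T] -> [set: T * bool] #<= [set: T].
Proof.
move=> Tinf.
(* The first clause makes [G] functional and injective. By the second, a point that occurs as a
   first argument or as a value is a first argument with both tags, so [G] maps D x bool into D. *)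
pose P (G : set ((T * bool) * T)) :=
  (forall p q, G p -> G q -> (p.1 = q.1 <-> p.2 = q.2)) /\
  (forall x b y, G ((x, b), y) ->
     (forall c, exists z, G ((x, c), z)) /\ (forall c, exists z, G ((y, c), z))).
have [F FP Ftot|G [[Ginj Gdom] Gmax]] := @Zorn_bigcup _ P.
  split=> [p q [X FX Xp] [Y FY Yq]|x b y [X FX Xp]].
    have [Z FZ [Zp Zq]] := chain_upper2 Ftot FX FY Xp Yq.
    exact: (FP _ FZ).1.
  have [h1 h2] := (FP _ FX).2 _ _ _ Xp.
  split=> c; [have [z Xz] := h1 c|have [z Xz] := h2 c]; exists z; exists X => //.
pose D := [set x | exists b y, G ((x, b), y)].
have Dtot x b : D x -> exists2 y, D y & G ((x, b), y).
  move=> [c [y /Gdom[/(_ b)[z Gz] _]]]; exists z => //.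
  have [_ /(_ true)[t Gt]] := Gdom _ _ _ Gz.
  by exists true, t.
have Dimg x b y : G ((x, b), y) -> D x /\ D y.
  by move=> /[dup] Gxy /Gdom[_ /(_ true)[z Gyz]]; split; [exists b, y|exists true, z].
have leD : setX D [set: bool] #<= D.
  apply/card_le_relP; exists (fun p y => G (p, y)); split=> [[x b] [/= Dx _]|].
    exact: Dtot.
  by move=> p q y _ _ Gp Gq; exact/(Ginj _ _ Gp Gq).
have Cfin : finite_set (~` D).
  apply: contrapT => /infiniteP/card_le_relP[N [Ntot Ninj]].
  have /choice[g gP] : forall n, exists y, ~ D y /\ N n y.
    by move=> n; have [y Dy Ny] := Ntot n I; exists y.
  have ginj : injective g.
    move=> m n e; apply: Ninj (gP m).2 _ => //.
    by rewrite e; exact: (gP n).2.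
  have [] := Gmax (G `|` [set p | exists n (b : bool),
      p = ((g n, b), g (b + n.*2)%N)]).
    split=> [p|/(_ ((g 0%N, false), g 0%N)) Gg]; first by left.
    have /Gg/Dimg[+ _] : (G `|` [set p | exists n (b : bool),
      p = ((g n, b), g (b + n.*2)%N)]) ((g 0%N, false), g 0%N).
      by right; exists 0%N, false.
    exact: (gP 0%N).1.
  split=> [p q [Gp|[n [b ->]]] [Gq|[m [c ->]]]|x b y [Gp|[n [c [-> _ ->]]]]].
  - exact: Ginj.
  - case: p Gp => [[x b'] y] /Dimg[Dx Dy]; split=> /= e; exfalso.
      by case: e => e _; apply: (gP m).1; rewrite -e.
    by apply: (gP (c + m.*2)%N).1; rewrite -e.
  - case: q Gq => [[x b'] y] /Dimg[Dx Dy]; split=> /= e; exfalso.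
      by case: e => e _; apply: (gP n).1; rewrite e.
    by apply: (gP (b + n.*2)%N).1; rewrite e.
  - split=> /= [[/ginj -> ->] //|/ginj e].
    (* The tag is recovered as the parity of the index. *)
    have bc : b = c.
      by have /(congr1 odd) := e; rewrite !oddD !odd_double !addbF; case: (b); case: (c).
    by move: e; rewrite bc => /addnI/double_inj ->.
  - have [h1 h2] := Gdom _ _ _ Gp.
    by split=> d; [have [z Xz] := h1 d|have [z Xz] := h2 d]; exists z; left.
  - by split=> d; eexists; right; do 2 eexists.
have Dinf : infinite_set D.
  by move=> Dfin; apply: Tinf; rewrite -(setUv D) finite_setU.
(* [T] goes into two copies of [D]: the points of [D] into the copy tagged [false], the finitely
   many others into the copy tagged [true]. *)
have leT : [set: T] #<= D.
  apply: card_le_trans leD.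
  have /card_le_relP[N [Ntot Ninj]] : ~` D #<= D.
    exact: card_le_trans (finite_set_countable Cfin) ((infiniteP D).1 Dinf).
  apply/card_le_relP.
  exists (fun x p => if p.2 then ~ D x /\ N x p.1 else D x /\ x = p.1); split.
    move=> x _; have [Dx|/[dup] Dx /Ntot[y Dy Nxy]] := pselect (D x).
      by exists (x, false).
    by exists (y, true).
  move=> x x' [y [|]] _ _ /= [Dx +] [Dx' +]; first exact: Ninj.
  by move=> -> ->.
have /card_le_relP[N [Ntot Ninj]] := leT.
apply: card_le_trans (card_leT D); apply: card_le_trans leD.
apply/card_le_relP; exists (fun p q => N p.1 q.1 /\ p.2 = q.2); split.
  by move=> [x b] _; have [y Dy Nxy] := Ntot x I; exists (y, b).
move=> [x b] [x' b'] [y c] _ _ /= [Nx ->] [Nx' ->].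
by rewrite (Ninj x x' y).
Qed.

Lemma card_leU_double T U (A B : set T) (C : set U) :
  A #<= C -> B #<= C -> A `|` B #<= setX C [set: bool].
Proof.
move=> /card_le_relP[R [Rtot Rinj]] /card_le_relP[S [Stot Sinj]].
apply/card_le_relP.
exists (fun x p => if p.2 then A x /\ R x p.1 else B x /\ S x p.1); split.
  move=> x [/[dup] Ax /Rtot[y Cy Rxy]|/[dup] Bx /Stot[y Cy Sxy]].
    by exists (y, true).
  by exists (y, false).
move=> x x' [y [|]] _ _ /= [xA +] [x'A +]; [exact: Rinj|exact: Sinj].
Qed.

Lemma card_leU T U (A B : set T) (C : set U) :
  infinite_set C -> A #<= C -> B #<= C -> A `|` B #<= C.
Proof.
move=> Cinf leAC leBC; apply: card_le_trans (card_leU_double leAC leBC) _.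
have := @card_le_double C; rewrite (eq_finite_set (card_setT C)) => /(_ Cinf).
rewrite (card_le_eqr (card_setT C)); apply: card_le_trans.
apply/card_le_relP; exists (fun p q => set_val q.1 = p.1 /\ p.2 = q.2); split.
  by move=> [x b] [/= Cx _]; exists (SigSub (mem_set Cx), b).
by move=> [x b] [x' b'] [y c] _ _ /= [<- ->] [<- ->].
Qed.

(** By comparability [A] may be taken to be the smaller set. If [B] is infinite it absorbs the
    union; if [B] is finite, so are the union and [C]. In this form the result splits long chains
    and large antichains. *)
Lemma card_geU T U (A B : set T) (C : set U) :
  infinite_set C -> C #<= A `|` B -> C #<= A \/ C #<= B.
Proof.
move=> Cinf CAB.
wlog AB : A B CAB / A #<= B => [wlogAB|].
  have [AB|BA] := card_le_total A B; first exact: wlogAB.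
  by rewrite orC; apply: wlogAB => //; rewrite setUC.
right; have [Bfin|Binf] := pselect (finite_set B); last first.
  exact: card_le_trans CAB (card_leU Binf AB (card_lexx B)).
case: Cinf; apply: card_le_finite CAB _; rewrite finite_setU; split=> //.
exact: card_le_finite AB Bfin.
Qed.

Lemma card_ltU T (A B : set T) (lam : Type) :
  infinite_set [set: lam] -> card_lt A lam -> card_lt B lam ->
  card_lt (A `|` B) lam.
Proof.
move=> lam_inf [Ale /negP Age] [Ble /negP Bge]; split; first exact: card_leU.
by apply/negP => /(card_geU lam_inf)[].
Qed.

Lemma card_II_setU T (A B : set T) a b c :
  A #= `I_a -> B #= `I_b -> A `&` B #= `I_c -> A `|` B #= `I_(a + b - c).
Proof.
(* The finite sets of [finmap] live over a [choiceType], which [{classic T}] supplies. *)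
suff choice_case (U : choiceType) (X Y : set U) :
    X #= `I_a -> Y #= `I_b -> X `&` Y #= `I_c -> X `|` Y #= `I_(a + b - c).
  exact: (choice_case {classic T}).
move=> Xa Yb XYc.
have Xfin : finite_set X by exists a.
have Yfin : finite_set Y by exists b.
have XYfin : finite_set (X `|` Y) by rewrite finite_setU.
rewrite -(fset_setK XYfin); apply/card_eq_fsetP.
rewrite fset_setU // finmap.cardfsU -fset_setI //.
by rewrite (card_fset_set Xa) (card_fset_set Yb) (card_fset_set XYc).
Qed.

(** * Amalgams of transitive relations *)

Section RelationAmalgam.
Variable X : Type.
Implicit Types (P : set X) (R S : X -> X -> Prop).

Definition amalgam_rel R S (x y : X) : Prop :=
  [\/ R x y, S x y, exists2 z, R x z & S z y | exists2 z, S x z & R z y].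

Lemma amalgam_relC R S : amalgam_rel R S = amalgam_rel S R.
Proof.
by apply/funext => x; apply/funext => y; apply/propext; split=> -[]; constructor.
Qed.

(** Reversal exchanges the two kinds of composite. Symmetry and the reversing axioms thereby reduce
    to the monotonicity lemmas. *)
Lemma amalgam_rel_flip R S x y :
  amalgam_rel R S y x <->
  amalgam_rel (fun u v => R v u) (fun u v => S v u) x y.
Proof.
split=> -[Rxy|Sxy|[z xz zy]|[z xz zy]];
  by [constructor 1|constructor 2|constructor 4; exists z|constructor 3; exists z].
Qed.

Lemma amalgam_rel_homo R S R' S' (f : X -> X) :
  (forall x y, R x y -> R' (f x) (f y)) ->
  (forall x y, S x y -> S' (f x) (f y)) ->
  forall x y, amalgam_rel R S x y -> amalgam_rel R' S' (f x) (f y).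
Proof.
move=> fR fS x y [/fR|/fS|[z /fR Rxz /fS Szy]|[z /fS Sxz /fR Rzy]].
- by constructor 1.
- by constructor 2.
- by constructor 3; exists (f z).
- by constructor 4; exists (f z).
Qed.

Lemma amalgam_rel_sub R S R' S' :
  (forall x y, R x y -> R' x y) -> (forall x y, S x y -> S' x y) ->
  forall x y, amalgam_rel R S x y -> amalgam_rel R' S' x y.
Proof. exact: (amalgam_rel_homo (f := id)). Qed.

Definition supported P R := forall x y, R x y -> P x /\ P y.

Definition agree_on P R S := forall x y, P x -> P y -> R x y <-> S x y.

Variables (P Q : set X) (R S : X -> X -> Prop).
Hypotheses (RP : supported P R) (SQ : supported Q S).
Hypothesis (RS : agree_on (P `&` Q) R S).
Hypotheses (Rtr : forall x y z, R x y -> R y z -> R x z).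

(** When [x] and [y] lie in [P], an [S]-step on the way has both ends in the overlap of [P] and [Q],
    hence is an [R]-step. *)
Lemma amalgam_rel_restrict x y : P x -> P y -> amalgam_rel R S x y -> R x y.
Proof.
move=> Px Py [//|Sxy|[z Rxz Szy]|[z Sxz Rzy]].
- by have [Qx Qy] := SQ Sxy; apply/RS.
- have [Qz Qy] := SQ Szy; have [_ Pz] := RP Rxz.
  by apply: Rtr Rxz _; apply/RS.
- have [Qx Qz] := SQ Sxz; have [Pz _] := RP Rzy.
  by apply: Rtr _ Rzy; apply/RS.
Qed.

Lemma amalgam_rel_comp x y z : R x y -> amalgam_rel R S y z -> amalgam_rel R S x z.
Proof.
move=> Rxy; have [_ Py] := RP Rxy.
move=> [Ryz|Syz|[t Ryt Stz]|[t Syt Rtz]].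
- by constructor 1; apply: Rtr Ryz.
- by constructor 3; exists y.
- by constructor 3; exists t => //; apply: Rtr Ryt.
(* The composite from [y] to [z] begins and ends in [P], so it collapses to one [R]-step. *)
- constructor 1; apply: (Rtr Rxy); apply: amalgam_rel_restrict => //.
    exact: (RP Rtz).2.
  by constructor 4; exists t.
Qed.

End RelationAmalgam.

Section RelationAmalgamTheory.
Variables (X : Type) (P Q : set X) (R S : X -> X -> Prop).
Hypotheses (RP : supported P R) (SQ : supported Q S).
Hypothesis (RS : agree_on (P `&` Q) R S).
Hypotheses (Rtr : forall x y z, R x y -> R y z -> R x z).
Hypotheses (Str : forall x y z, S x y -> S y z -> S x z).

Let SR : agree_on (Q `&` P) S R.
Proof. by move=> x y [Qx Px] [Qy Py]; apply: iff_sym; apply: RS. Qed.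

Lemma amalgam_rel_trans x y z :
  amalgam_rel R S x y -> amalgam_rel R S y z -> amalgam_rel R S x z.
Proof.
have compR u v w : R u v -> amalgam_rel R S v w -> amalgam_rel R S u w.
  exact: (amalgam_rel_comp RP SQ).
have compS u v w : S u v -> amalgam_rel R S v w -> amalgam_rel R S u w.
  rewrite amalgam_relC; exact: (amalgam_rel_comp SQ RP).
move=> [Rxy|Sxy|[t Rxt Sty]|[t Sxt Rty]] yz.
- exact: compR yz.
- exact: compS yz.
- exact: compR Rxt (compS _ _ _ Sty yz).
- exact: compS Sxt (compR _ _ _ Rty yz).
Qed.

(** A loop of two steps has both of its points in the overlap. Its [S]-step is then an [R]-step, and
    transitivity yields an [R]-loop at [z]. *)
Lemma amalgam_rel_irrefl :
  (forall x, ~ R x x) -> (forall x, ~ S x x) -> forall x, ~ amalgam_rel R S x x.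
Proof.
move=> Rirr Sirr x [/Rirr|/Sirr|[z Rxz Szx]|[z Sxz Rzx]] //.
  apply: (Rirr z); apply: (Rtr _ Rxz); apply/RS => //.
    by split; [exact: (RP Rxz).2|exact: (SQ Szx).1].
  by split; [exact: (RP Rxz).1|exact: (SQ Szx).2].
apply: (Rirr z); apply: (Rtr Rzx _); apply/RS => //.
  by split; [exact: (RP Rzx).2|exact: (SQ Sxz).1].
by split; [exact: (RP Rzx).1|exact: (SQ Sxz).2].
Qed.

(** The new case has [x] in [P] only and [y] in [Q] only, so that [x] reaches [y] through some [z]
    of the overlap. Going back from [z] through [y] to [x] relates [z] to [x] inside [P]; then
    [x = z] lies in [Q], a contradiction. *)
Lemma amalgam_rel_antisym :
  (forall x, P x \/ Q x) ->
  (forall x y, R x y -> R y x -> x = y) -> (forall x y, S x y -> S y x -> x = y) ->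
  forall x y, amalgam_rel R S x y -> amalgam_rel R S y x -> x = y.
Proof.
move=> PQ Ranti Santi.
have toR := amalgam_rel_restrict RP SQ RS Rtr.
have toS x y : Q x -> Q y -> amalgam_rel R S x y -> S x y.
  by rewrite amalgam_relC; exact: (amalgam_rel_restrict SQ RP SR Str).
have mixed x y : P x -> Q y -> amalgam_rel R S x y -> amalgam_rel R S y x -> x = y.
  move=> Px Qy xy yx.
  have [Qx|nQx] := pselect (Q x); first by apply: Santi; apply: toS.
  have [Py|nPy] := pselect (P y); first by apply: Ranti; apply: toR.
  case: (xy) => [/RP[]|/SQ[]|[z Rxz Szy]|[z /SQ[]]] //.
  case: nQx; suff -> : x = z by exact: (SQ Szy).1.
  apply: (Ranti _ _ Rxz); apply: toR => //; first exact: (RP Rxz).2.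
  by apply: amalgam_rel_trans yx; constructor 2.
move=> x y xy yx; have [Px|Qx] := PQ x; have [Py|Qy] := PQ y.
- by apply: Ranti; apply: toR.
- exact: mixed.
- exact/esym/mixed.
- by apply: Santi; apply: toS.
Qed.

Hypothesis PQ : forall x, P x \/ Q x.
Hypothesis Ranti : forall x y, R x y -> R y x -> x = y.
Hypothesis Santi : forall x y, S x y -> S y x -> x = y.

(** A composite with a trivial step is a single step. Conversely, if a composite of two strict steps
    returned to its start, its midpoint would be related both ways to a different point, against
    antisymmetry of the amalgam. *)
Lemma amalgam_rel_strict x y :
  strict (amalgam_rel R S) x y <-> amalgam_rel (strict R) (strict S) x y.
Proof.
split=> [[xy ne]|].
  case: xy => [Rxy|Sxy|[z Rxz Szy]|[z Sxz Rzy]]; [by constructor 1|by constructor 2|..].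
    have [xz|nxz] := pselect (x = z); first by constructor 2; split=> //; rewrite xz.
    have [zy|nzy] := pselect (z = y); first by constructor 1; split=> //; rewrite -zy.
    by constructor 3; exists z.
  have [xz|nxz] := pselect (x = z); first by constructor 1; split=> //; rewrite xz.
  have [zy|nzy] := pselect (z = y); first by constructor 2; split=> //; rewrite -zy.
  by constructor 4; exists z.
have anti := amalgam_rel_antisym PQ Ranti Santi.
move=> xy; split; first by apply: amalgam_rel_sub xy => ? ? [].
move=> exy; move: xy; rewrite exy => -[[_ //]|[_ //]|[z [Ryz ne] [Szy _]]|
    [z [Syz ne] [Rzy _]]];
  by apply: ne; apply: anti; [constructor|constructor].
Qed.

Lemma amalgam_rel_strict_homo (f : X -> X) :
  (forall x y, strict R x y -> strict R (f x) (f y)) ->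
  (forall x y, strict S x y -> strict S (f x) (f y)) ->
  forall x y, strict (amalgam_rel R S) x y -> strict (amalgam_rel R S) (f x) (f y).
Proof.
move=> fR fS x y /amalgam_rel_strict xy.
by apply/amalgam_rel_strict; apply: amalgam_rel_homo xy.
Qed.

Lemma amalgam_rel_strict_antihomo (f : X -> X) :
  (forall x y, strict R x y -> strict R (f y) (f x)) ->
  (forall x y, strict S x y -> strict S (f y) (f x)) ->
  forall x y, strict (amalgam_rel R S) x y -> strict (amalgam_rel R S) (f y) (f x).
Proof.
move=> fR fS x y /amalgam_rel_strict xy; apply/amalgam_rel_strict.
by apply/amalgam_rel_flip; apply: amalgam_rel_homo xy.
Qed.

End RelationAmalgamTheory.

(** * Glued structures *)

Definition push X Y (e : X -> Y) (R : X -> X -> Prop) (x y : Y) : Prop :=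
  exists u v, [/\ e u = x, e v = y & R u v].

Lemma push_inj X Y (e : X -> Y) (R : X -> X -> Prop) u v :
  injective e -> push e R (e u) (e v) <-> R u v.
Proof. by move=> einj; split=> [[_ [_ [/einj-> /einj->]]]|]; last by exists u, v. Qed.

Lemma push_supported X Y (e : X -> Y) (R : X -> X -> Prop) :
  supported (range e) (push e R).
Proof. by move=> _ _ [u [v [<- <- _]]]. Qed.

Lemma push_trans X Y (e : X -> Y) (R : X -> X -> Prop) :
  injective e -> (forall x y z, R x y -> R y z -> R x z) ->
  forall x y z, push e R x y -> push e R y z -> push e R x z.
Proof.
move=> einj Rtr _ _ _ [u [v [<- <- Ruv]]] [v' [w [/einj -> <- Rvw]]].
by apply/push_inj => //; exact: Rtr Rvw.
Qed.

Lemma push_coarser X Y (e : X -> Y) (R S : X -> X -> Prop) :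
  (forall x y, R x y -> S x y) -> forall x y, push e R x y -> push e S x y.
Proof. by move=> RS x y [u [v [<- <- /RS]]]; exists u, v. Qed.

Lemma push_antisym X Y (e : X -> Y) (R : X -> X -> Prop) : injective e ->
  (forall x y, R x y -> R y x -> x = y) ->
  forall x y, push e R x y -> push e R y x -> x = y.
Proof.
by move=> einj anti _ _ [u [v [<- <- uv]]] /(push_inj _ _ _ einj) vu; rewrite (anti u v).
Qed.

Lemma strict_push X Y (e : X -> Y) (R : X -> X -> Prop) x y : injective e ->
  strict (push e R) x y <-> push e (strict R) x y.
Proof.
move=> einj; split=> [[[u [v [<- <- uv]]] ne]|[u [v [<- <- [uv ne]]]]].
  by exists u, v; split=> //; split=> // uv'; apply: ne; rewrite uv'.
by split=> [|/einj //]; exists u, v.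
Qed.

Lemma pair_args_map n X Y (e : X -> Y) (x y : X) :
  (fun i : 'I_n => e (pair_args x y i)) = pair_args (e x) (e y).
Proof. by apply/funext => i; rewrite /pair_args; case: eqP. Qed.

(** Arity 2 is a propositional equation because [rarity r] does not compute for a symbol of an
    abstract language. *)
Lemma pair_argsE n X (t : 'I_n -> X) :
  n = 2 -> exists x y, t = pair_args x y.
Proof.
move=> n2; subst n; exists (t ord0), (t ord_max); apply/funext => i.
rewrite /pair_args; case: eqP => [i0|]; first by congr t; apply: val_inj.
by case: i => -[//|[|//]] i _; congr t; apply: val_inj.
Qed.

Lemma pair_args_inj n X (x y x' y' : X) : n = 2 ->
  pair_args (n := n) x y = pair_args x' y' -> x = x' /\ y = y'.
Proof.
by move=> -> e; split; [have := congr1 (@^~ ord0) e|have := congr1 (@^~ ord_max) e].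
Qed.

Lemma bin_embedding L X Y (M : structure L X) (N : structure L Y) e r x y :
  embedding M N e -> bin M r x y <-> bin N r (e x) (e y).
Proof. by move=> [_ _ eR]; rewrite /bin -pair_args_map; exact: eR. Qed.

(** A strong amalgam as a square of embeddings between types: [MC] is the pullback, and [MA] and
    [MB] jointly cover [MD]. Freed from an ambient set, the notion passes directly to reducts. *)
Record gluing L XA XB XC XD (MA : structure L XA) (MB : structure L XB)
    (MC : structure L XC) (MD : structure L XD)
    (jA : XC -> XA) (jB : XC -> XB) (eA : XA -> XD) (eB : XB -> XD) : Prop :=
  Gluing {
    gluing_jA : embedding MC MA jA;
    gluing_jB : embedding MC MB jB;
    gluing_eA : embedding MA MD eA;
    gluing_eB : embedding MB MD eB;
    gluing_comm : forall c, eA (jA c) = eB (jB c);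
    gluing_pullback : forall a b, eA a = eB b -> exists2 c, a = jA c & b = jB c;
    gluing_cover : forall d, range eA d \/ range eB d }.

Definition freely_glued_rel L XA XB XD (MA : structure L XA) (MB : structure L XB)
    (MD : structure L XD) (eA : XA -> XD) (eB : XB -> XD) (r : rsym L) : Prop :=
  forall x y, bin MD r x y <->
    amalgam_rel (push eA (bin MA r)) (push eB (bin MB r)) x y.

(* A value at arguments that lie neither in A nor in B is one of the arguments,
   so that every union of a closed subset of A and a closed subset of B is
   closed. *)
Definition projecting L XA XB XD (MD : structure L XD)
    (eA : XA -> XD) (eB : XB -> XD) : Prop :=
  forall (f : fsym L) (t : 'I_(farity f) -> XD),
    [\/ exists s, t = (fun i => eA (s i)), exists s, t = (fun i => eB (s i))
      | exists i, fint MD t = t i].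

Section GluingExists.
Variables (L : language) (XA XB XC XD : Type).
Variables (MA : structure L XA) (MB : structure L XB) (MC : structure L XC).
Variables (jA : XC -> XA) (jB : XC -> XB) (eA : XA -> XD) (eB : XB -> XD).
Hypotheses (jAP : embedding MC MA jA) (jBP : embedding MC MB jB).
Hypotheses (eAI : injective eA) (eBI : injective eB).
Hypothesis comm : forall c, eA (jA c) = eB (jB c).
Hypothesis pullback : forall a b, eA a = eB b -> exists2 c, a = jA c & b = jB c.
Hypothesis cover : forall d, range eA d \/ range eB d.

Lemma pullback_fun n (s : 'I_n -> XA) (s' : 'I_n -> XB) :
  (fun i => eA (s i)) = (fun i => eB (s' i)) ->
  exists2 u, s = (fun i => jA (u i)) & s' = (fun i => jB (u i)).
Proof.
move=> e.
have /choice[u uP] : forall i, exists c, s i = jA c /\ s' i = jB c.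
  by move=> i; have [c -> ->] := pullback (congr1 (@^~ i) e); exists c.
by exists u; apply/funext => i; have [] := uP i.
Qed.

Lemma comp_inj n X Y (e : X -> Y) (s s' : 'I_n -> X) : injective e ->
  (fun i => e (s i)) = (fun i => e (s' i)) -> s = s'.
Proof. by move=> einj e'; apply/funext => i; apply: einj; exact: (congr1 (@^~ i) e'). Qed.

Lemma glued_value (f : fsym L) (t : 'I_(farity f) -> XD) : exists y,
  [/\ forall s, t = (fun i => eA (s i)) -> y = eA (fint MA s),
      forall s, t = (fun i => eB (s i)) -> y = eB (fint MB s)
    & [\/ exists s, t = (fun i => eA (s i)), exists s, t = (fun i => eB (s i))
        | exists i, y = t i]].
Proof.
have [[s ts]|nA] := pselect (exists s, t = (fun i => eA (s i))).
  exists (eA (fint MA s)); split=> [s'|s'|]; last by constructor 1; exists s.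
    by rewrite ts => /(comp_inj eAI) ->.
  rewrite ts => /pullback_fun[u -> ->].
  by have [[_ <- _] [_ <- _]] := (jAP, jBP).
have [[s ts]|nB] := pselect (exists s, t = (fun i => eB (s i))).
  exists (eB (fint MB s)); split=> [s' ts'|s'|]; last by constructor 2; exists s.
    by case: nA; exists s'.
  by rewrite ts => /(comp_inj eBI) ->.
(* The empty tuple comes from A, so a mixed tuple has an entry to return. *)
have [f0|[i]] : farity f = 0 \/ inhabited 'I_(farity f).
  case: (farity f) => [|n]; [by left|by right; constructor; exact: ord0].
  have /choice[s sP] : forall i, exists a, t i = eA a.
    by move=> i; have := ltn_ord i; rewrite {2}f0.
  by case: nA; exists s; apply/funext.
exists (t i); split=> [s ts|s ts|]; [by case: nA; exists s|by case: nB; exists s|].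
by constructor 3; exists i.
Qed.

Let related_in r := amalgam_rel (push eA (bin MA r)) (push eB (bin MB r)).

Lemma push_agree r :
  agree_on (range eA `&` range eB) (push eA (bin MA r)) (push eB (bin MB r)).
Proof.
move=> _ _ [[a _ <-] [b _ /esym/pullback[c -> _]]]
  [[a' _ <-] [b' _ /esym/pullback[c' -> _]]].
rewrite push_inj // !comm push_inj //.
by rewrite -(bin_embedding _ _ _ jAP) -(bin_embedding _ _ _ jBP).
Qed.

Variable Q : set (rsym L).
Hypothesis Q2 : forall r, Q r -> rarity r = 2.
Hypothesis MAtr : forall r, Q r -> forall x y z,
  bin MA r x y -> bin MA r y z -> bin MA r x z.
Hypothesis MBtr : forall r, Q r -> forall x y z,
  bin MB r x y -> bin MB r y z -> bin MB r x z.

(** [Q] collects the transitive binary symbols, which receive composites; other relations are plain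
    unions. Transitivity ensures that the composites add nothing inside A or inside B, so both maps
    still reflect the relations. *)
Lemma gluing_exists : exists MD : structure L XD,
  [/\ gluing MA MB MC MD jA jB eA eB, projecting MD eA eB
    & forall r, Q r -> freely_glued_rel MA MB MD eA eB r].
Proof.
pose F (f : fsym L) t := sval (cid (@glued_value f t)).
have FP f t := svalP (cid (@glued_value f t)).
pose Rel (r : rsym L) (t : 'I_(rarity r) -> XD) :=
  [\/ exists2 s, t = (fun i => eA (s i)) & rint MA s,
      exists2 s, t = (fun i => eB (s i)) & rint MB s
    | Q r /\ exists x y, t = pair_args x y /\ related_in r x y].
exists (Structure F Rel).
have toA r x y : Q r -> range eA x -> range eA y ->
    related_in r x y -> push eA (bin MA r) x y.
  move=> Qr; apply: (amalgam_rel_restrict (@push_supported _ _ eA _)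
    (@push_supported _ _ eB _) (@push_agree r) (push_trans eAI (MAtr Qr))).
have toB r x y : Q r -> range eB x -> range eB y ->
    related_in r x y -> push eB (bin MB r) x y.
  move=> Qr; rewrite /related_in amalgam_relC.
  apply: (amalgam_rel_restrict (@push_supported _ _ eB _)
    (@push_supported _ _ eA _) _ (push_trans eBI (MBtr Qr))).
  by move=> u v [uB uA] [vB vA]; apply: iff_sym; exact: push_agree.
have embA : embedding MA (Structure F Rel) eA.
  split=> // [f t|r s]; first by have [/(_ _ erefl)] := FP f (fun i => eA (t i)).
  split=> [Ms|[[s' /(comp_inj eAI) -> //]|[s' /pullback_fun[u -> ->]]|]].
  - by constructor 1; exists s.
  - by have [[_ _ <-] [_ _ <-]] := (jAP, jBP).
  - move=> [Qr [x [y [es xy]]]].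
    have [u [v suv]] := pair_argsE s (Q2 Qr); rewrite suv.
    move: es; rewrite suv pair_args_map => /(pair_args_inj (Q2 Qr))[eu ev].
    move: xy; rewrite -eu -ev => /(toA _ _ _ Qr (imageT _ _) (imageT _ _)).
    by rewrite push_inj.
have embB : embedding MB (Structure F Rel) eB.
  split=> // [f t|r s]; first by have [_ /(_ _ erefl)] := FP f (fun i => eB (t i)).
  split=> [Ms|[[s' /esym/pullback_fun[u -> ->]]|[s' /(comp_inj eBI) -> //]|]].
  - by constructor 2; exists s.
  - by have [[_ _ <-] [_ _ <-]] := (jAP, jBP).
  - move=> [Qr [x [y [es xy]]]].
    have [u [v suv]] := pair_argsE s (Q2 Qr); rewrite suv.
    move: es; rewrite suv pair_args_map => /(pair_args_inj (Q2 Qr))[eu ev].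
    move: xy; rewrite -eu -ev => /(toB _ _ _ Qr (imageT _ _) (imageT _ _)).
    by rewrite push_inj.
split=> // [f t|r Qr x y]; first by have [_ _] := FP f t.
split=> [|xy]; last by constructor 3; split=> //; exists x, y.
move=> [[s xys Ms]|[s xys Ms]|[_ [u [v [/(pair_args_inj (Q2 Qr))[-> ->] //]]]]].
- constructor 1; have [u [v suv]] := pair_argsE s (Q2 Qr).
  move: xys Ms; rewrite suv pair_args_map => /(pair_args_inj (Q2 Qr))[-> ->] Muv.
  by exists u, v.
- constructor 2; have [u [v suv]] := pair_argsE s (Q2 Qr).
  move: xys Ms; rewrite suv pair_args_map => /(pair_args_inj (Q2 Qr))[-> ->] Muv.
  by exists u, v.
Qed.

End GluingExists.

(** * Conditions on glued structures *)

Lemma card_lt_image X Y (e : X -> Y) (P : set X) lam :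
  injective e -> card_lt P lam -> card_lt (e @` P) lam.
Proof.
move=> einj; have eP : e @` P #= P by apply: inj_card_eq => x y _ _ /einj.
by rewrite /card_lt (card_le_eql eP) (card_le_eqr eP).
Qed.

(** Double induction. For [x] in [P], each [y] in [Q] below [x] is accessible by induction along
    [Q]: a predecessor of [y] in [P] is below [x] by transitivity and falls under the outer
    induction. The points of [Q] follow by one more induction along [Q]. *)
Lemma well_foundedU X (lt : X -> X -> Prop) (P Q : set X) :
  (forall x y z, lt x y -> lt y z -> lt x z) ->
  well_founded (fun x y => [/\ P x, P y & lt x y]) ->
  well_founded (fun x y => [/\ Q x, Q y & lt x y]) ->
  well_founded (fun x y => [/\ (P `|` Q) x, (P `|` Q) y & lt x y]).
Proof.
move=> tr wfP wfQ; set R := (X in well_founded X).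
have AccP x : P x -> Acc R x.
  elim/(well_founded_ind wfP): x => x IHx Px; constructor=> y [PQy _].
  elim/(well_founded_ind wfQ): y PQy => y IHy PQy yx.
  case: PQy => [Py|Qy]; first exact: IHx.
  constructor=> z [[Pz|Qz] _ zy]; first by apply: IHx => //; split=> //; exact: tr yx.
  by apply: IHy => //; [right|exact: tr yx].
move=> x; elim/(well_founded_ind wfQ): x => x IHx; constructor=> y [[Py|Qy] PQx yx].
  exact: AccP.
case: PQx => [Px|Qx]; last exact: IHx.
by have [] := AccP x Px; apply; split=> //; [right|left].
Qed.

Lemma well_founded_image X Y (e : X -> Y) (lt : X -> X -> Prop)
    (lt' : Y -> Y -> Prop) (P : set X) :
  injective e -> (forall x y, lt' (e x) (e y) -> lt x y) ->
  well_founded (fun x y => [/\ P x, P y & lt x y]) ->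
  well_founded (fun x y => [/\ (e @` P) x, (e @` P) y & lt' x y]).
Proof.
move=> einj ltP wfP; set R := (X in well_founded X).
have Acce x : Acc R (e x).
  elim/(well_founded_ind wfP): x => x IHx; constructor=> y [[u Pu <-] [v Pv /einj vx]].
  by move=> /ltP ux; apply: IHx; rewrite vx in Pv.
by move=> y; constructor=> _ [[u _ <-] _ _].
Qed.

Lemma well_order_sub (W : Type) (le : rel W) (S : set W) :
  well_order le -> well_order (fun x y : S => le (set_val x) (set_val y)).
Proof.
move=> wo A [x Ax].
pose A' : {pred W} := fun w => `[< exists2 z : S, z \in A & set_val z = w >].
have [|w [[/asboolP[z Az zw] wmin] wuniq]] := wo A'.
  by exists (set_val x); apply/asboolP; exists x.
exists z; split=> [|z' [Az' z'min]].
  by split=> // y Ay; rewrite zw; apply: wmin; apply/asboolP; exists y.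
apply: val_inj; rewrite -[LHS]/(set_val z) zw; apply: wuniq; split.
  by apply/asboolP; exists z'.
by move=> _ /asboolP[y Ay <-]; exact: z'min.
Qed.

(** The indices sent to [P] or those sent to [Q] are at least [lam] in number, and they inherit the
    well-order. Measuring length by cardinality makes this work for singular [lam] too. *)
Lemma increasing_chainU X (P Q : set X) (R : X -> X -> Prop) lam :
  infinite_set [set: lam] -> increasing_chain (P `|` Q) R lam ->
  increasing_chain P R lam \/ increasing_chain Q R lam.
Proof.
move=> lam_inf [W [le [s [wo Wlam sPQ sincr]]]].
have sub_chain (S : set X) : card_ge (s @^-1` S) lam -> increasing_chain S R lam.
  move=> Slam; exists (set_type (s @^-1` S)), (fun x y => le (set_val x) (set_val y)),
    (fun w => s (set_val w)); split.
  - exact: well_order_sub.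
  - by rewrite /card_ge (card_le_eqr (card_setT _)).
  - by move=> w; have := set_valP w.
  - by move=> w w' ww' neq; apply: sincr => // /val_inj.
have : [set: lam] #<= s @^-1` P `|` s @^-1` Q.
  by apply: card_le_trans Wlam (subset_card_le _) => w _; exact: sPQ.
by move=> /(card_geU lam_inf)[/sub_chain|/sub_chain]; [left|right].
Qed.

Lemma increasing_chain_image X Y (e : X -> Y) (P : set X) (R : X -> X -> Prop)
    (R' : Y -> Y -> Prop) lam :
  (forall x y, R' (e x) (e y) -> R x y) ->
  increasing_chain (e @` P) R' lam -> increasing_chain P R lam.
Proof.
move=> eR [W [le [s [wo Wlam seP sincr]]]].
have /choice[t tP] : forall w, exists x, P x /\ e x = s w.
  by move=> w; have [x Px <-] := seP w; exists x.
exists W, le, t; split=> // [w|w w' ww' neq]; first by have [] := tP w.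
have [R's ne] := sincr w w' ww' neq; split; last first.
  by move=> e'; apply: ne; rewrite -(tP w).2 -(tP w').2 e'.
by apply: eR; rewrite (tP w).2 (tP w').2.
Qed.

Lemma directed_edge_embedding L X Y (M : structure L X) (N : structure L Y) e k a b :
  embedding M N e -> directed_edge M k a b -> directed_edge N k (e a) (e b).
Proof.
move=> [einj ef eR] [t [Mt <- <-]]; exists (fun i => e (t i)); split=> //.
case: k t Mt => -[f|r] m n t /= Mt; last exact/eR.
by rewrite -ef Mt.
Qed.

Lemma joined_in_image X Y (e : X -> Y) (P : set X) (Q : set Y)
    (E : X -> X -> Prop) (E' : Y -> Y -> Prop) :
  (forall x, P x -> Q (e x)) -> (forall x y, E x y -> E' (e x) (e y)) ->
  joined_in P E -> forall x y, P x -> P y ->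
  clos_refl_trans Y (fun u v => [/\ Q u, Q v & E' u v]) (e x) (e y).
Proof.
move=> PQ EE' PE x y Px Py; elim: (PE x y Px Py) => [u v [Pu Pv Euv]|u|u v w _ uv _ vw].
- by apply: rt_step; split; [exact: PQ|exact: PQ|exact: EE'].
- exact: rt_refl.
- exact: rt_trans uv vw.
Qed.

(** * Conditions on matching subsets: the whole domains or the extents of a predicate *)

Section GluingConditions.
Variables (L : language) (XA XB XC XD : Type).
Variables (MA : structure L XA) (MB : structure L XB) (MC : structure L XC).
Variables (MD : structure L XD).
Variables (jA : XC -> XA) (jB : XC -> XB) (eA : XA -> XD) (eB : XB -> XD).
Hypothesis glued : gluing MA MB MC MD jA jB eA eB.
Hypothesis proj : projecting MD eA eB.
Variables (PA : set XA) (PB : set XB) (PC : set XC) (PD : set XD).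
Hypothesis PDA : forall a, PD (eA a) <-> PA a.
Hypothesis PDB : forall b, PD (eB b) <-> PB b.
Hypothesis PAC : forall c, PA (jA c) <-> PC c.

Let eAI : injective eA. Proof. by have [] := gluing_eA glued. Qed.
Let eBI : injective eB. Proof. by have [] := gluing_eB glued. Qed.
Let jAI : injective jA. Proof. by have [] := gluing_jA glued. Qed.

Lemma gluing_setU : PD = eA @` PA `|` eB @` PB.
Proof.
apply/seteqP; split=> [d PDd|_ [[a /PDA PDa <-]|[b /PDB PDb <-]]] //.
have [[a _ ad]|[b _ bd]] := gluing_cover glued d.
  by left; exists a => //; apply/PDA; rewrite ad.
by right; exists b => //; apply/PDB; rewrite bd.
Qed.

Lemma gluing_setI : eA @` PA `&` eB @` PB = (eA \o jA) @` PC.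
Proof.
apply/seteqP; split=> [_ [[a PAa <-] [b _ /esym]]|_ [c /PAC PAc <-]].
  move=> /(gluing_pullback glued)[c ac _].
  by exists c; rewrite /= -?ac //; apply/PAC; rewrite -ac.
split; first by exists (jA c).
by exists (jB c); [apply/PDB|]; rewrite -(gluing_comm glued) //; apply/PDA.
Qed.

(** [PD] is closed because a value at a mixed tuple is one of its entries. It is the least closed
    set because a closed set containing the generators pulls back along [eA] and [eB] to closed sets
    containing [GA] and [GB]. *)
Lemma gluing_generates GA GB : generates MA GA PA -> generates MB GB PB ->
  generates MD (eA @` GA `|` eB @` GB) PD.
Proof.
move=> genA genB.
have clA : closed_under_functions MA PA.
  rewrite -genA => f t Pt S SclG; apply: SclG.1 => i; exact: Pt.
have clB : closed_under_functions MB PB.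
  rewrite -genB => f t Pt S SclG; apply: SclG.1 => i; exact: Pt.
have GPA : GA `<=` PA by rewrite -genA => x Gx S [_ /(_ x Gx)].
have GPB : GB `<=` PB by rewrite -genB => x Gx S [_ /(_ x Gx)].
apply/seteqP; split.
  apply: smallest_sub.
    move=> f t Pt; have [_ fA _] := gluing_eA glued; have [_ fB _] := gluing_eB glued.
    have [[s ts]|[s ts]|[i ->]] := proj t; last exact: Pt.
      by rewrite ts -fA; apply/PDA/clA => i; apply/PDA; have := Pt i; rewrite ts.
    by rewrite ts -fB; apply/PDB/clB => i; apply/PDB; have := Pt i; rewrite ts.
  by move=> _ [[a /GPA PAa <-]|[b /GPB PBb <-]]; [apply/PDA|apply/PDB].
rewrite gluing_setU => d PDd S [Scl GS].
have [_ fA _] := gluing_eA glued; have [_ fB _] := gluing_eB glued.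
have SA : PA `<=` eA @^-1` S.
  rewrite -genA; apply: smallest_sub => [f t St|a Ga].
    by rewrite /preimage /= fA; exact: Scl.
  by apply: GS; left; exists a.
have SB : PB `<=` eB @^-1` S.
  rewrite -genB; apply: smallest_sub => [f t St|b Gb].
    by rewrite /preimage /= fB; exact: Scl.
  by apply: GS; right; exists b.
by case: PDd => [[a /SA Sa <-]|[b /SB Sb <-]].
Qed.

(** Every point is joined to and from the image of a fixed point of [PC]. Both directions are
    tracked since edges may be directed. *)
Lemma gluing_joined EA EB ED :
  (forall x y, EA x y -> ED (eA x) (eA y)) -> (forall x y, EB x y -> ED (eB x) (eB y)) ->
  PC !=set0 -> joined_in PA EA -> joined_in PB EB -> joined_in PD ED.
Proof.
move=> EAD EBD [c PCc] jnA jnB.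
have PAc : PA (jA c) by apply/PAC.
have PBc : PB (jB c) by apply/PDB; rewrite -(gluing_comm glued); apply/PDA.
have pathA x y (Px : PA x) (Py : PA y) :=
  joined_in_image (fun a => iffRL (PDA a)) EAD jnA Px Py.
have pathB x y (Px : PB x) (Py : PB y) :=
  joined_in_image (fun b => iffRL (PDB b)) EBD jnB Px Py.
have to_c d : PD d -> clos_refl_trans _ (fun u v => [/\ PD u, PD v & ED u v]) d (eA (jA c))
    /\ clos_refl_trans _ (fun u v => [/\ PD u, PD v & ED u v]) (eA (jA c)) d.
  rewrite {1}gluing_setU => -[[a PAa <-]|[b PBb <-]]; first by split; exact: pathA.
  by rewrite (gluing_comm glued); split; exact: pathB.
by move=> x y /to_c[xc _] /to_c[_ cy]; exact: rt_trans xc cy.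
Qed.

Let strictA r x y : strict (bin MD r) (eA x) (eA y) -> strict (bin MA r) x y.
Proof.
move=> [Rxy ne]; split; first exact/(bin_embedding r x y (gluing_eA glued)).
by move=> e; apply: ne; rewrite e.
Qed.

Let strictB r x y : strict (bin MD r) (eB x) (eB y) -> strict (bin MB r) x y.
Proof.
move=> [Rxy ne]; split; first exact/(bin_embedding r x y (gluing_eB glued)).
by move=> e; apply: ne; rewrite e.
Qed.

Lemma gluing_well_founded r : is_partial_order (bin MD r) ->
  well_founded (fun x y => [/\ PA x, PA y & strict (bin MA r) x y]) ->
  well_founded (fun x y => [/\ PB x, PB y & strict (bin MB r) x y]) ->
  well_founded (fun x y => [/\ PD x, PD y & strict (bin MD r) x y]).
Proof.
move=> [_ tr anti] wfA wfB; rewrite gluing_setU; apply: well_foundedU.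
- move=> x y z [xy nxy] [yz nyz]; split; first exact: tr yz.
  by move=> xz; apply: nyz; apply: anti => //; rewrite -xz.
- exact: well_founded_image eAI (@strictA r) wfA.
- exact: well_founded_image eBI (@strictB r) wfB.
Qed.

Lemma gluing_antichain r Y : Y `<=` PD -> antichain (bin MD r) Y ->
  exists YA YB, [/\ Y = eA @` YA `|` eB @` YB,
    YA `<=` PA /\ antichain (bin MA r) YA & YB `<=` PB /\ antichain (bin MB r) YB].
Proof.
move=> YP Yanti; exists (eA @^-1` Y), (eB @^-1` Y); split.
- apply/seteqP; split=> [d Yd|_ [[a Ya <-]|[b Yb <-]]] //.
  by have [[a _ ad]|[b _ bd]] := gluing_cover glued d;
    [left; exists a|right; exists b]; rewrite // /preimage /= ?ad ?bd.
- split=> [a /YP/PDA //|x y Yx Yy ne]; rewrite (bin_embedding r x y (gluing_eA glued)).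
  by apply: Yanti => // /eAI.
- split=> [b /YP/PDB //|x y Yx Yy ne]; rewrite (bin_embedding r x y (gluing_eB glued)).
  by apply: Yanti => // /eBI.
Qed.

Lemma holds_on_gluing (K : class L) (c : basic_condition L) :
  legitimate_basic K c -> K XD MD ->
  holds_on MA PA c -> holds_on MB PB c -> holds_on MC PC c ->
  (is_connectedness c -> PC !=set0) -> holds_on MD PD c.
Proof.
have edgeA k x y := @directed_edge_embedding _ _ _ _ _ _ k x y (gluing_eA glued).
have edgeB k x y := @directed_edge_embedding _ _ _ _ _ _ k x y (gluing_eB glued).
have leImA (Y : set XA) := card_image_le eA Y.
have leImB (Y : set XB) := card_image_le eB Y.
case: c => [|lam||lam|r|r lam|r lam|r|r lam|n m||s|Rs] /=.
- by move=> _ _ Afin Bfin _ _; rewrite gluing_setU finite_setU; split; apply: finite_image.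
- move=> lam_inf _ Alt Blt _ _; rewrite gluing_setU.
  by apply: card_ltU => //; apply: card_lt_image.
- move=> _ _ [GA [GAfin genA]] [GB [GBfin genB]] _ _.
  exists (eA @` GA `|` eB @` GB); split; last exact: gluing_generates.
  by rewrite finite_setU; split; apply: finite_image.
- move=> lam_inf _ [GA [GAlt genA]] [GB [GBlt genB]] _ _.
  exists (eA @` GA `|` eB @` GB); split; last exact: gluing_generates.
  by apply: card_ltU => //; apply: card_lt_image.
- by move=> [_ po] /po poD wfA wfB _ _; exact: gluing_well_founded.
- move=> [_ lam_inf] _ nA nB _ _; rewrite gluing_setU => /(increasing_chainU lam_inf).
  case=> /increasing_chain_image chain.
    by apply: nA; apply: chain => x y /(bin_embedding _ _ _ (gluing_eA glued)).
  by apply: nB; apply: chain => x y /(bin_embedding _ _ _ (gluing_eB glued)).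
- move=> [_ lam_inf] _ nA nB _ _; rewrite gluing_setU => /(increasing_chainU lam_inf).
  case=> /increasing_chain_image chain.
    by apply: nA; apply: chain => x y /(bin_embedding _ _ _ (gluing_eA glued)).
  by apply: nB; apply: chain => x y /(bin_embedding _ _ _ (gluing_eB glued)).
- move=> _ _ nA nB _ _.
  move=> [Y [YP /(gluing_antichain YP)[YA [YB [-> [YAP aA] [YBP aB]]]]]].
  rewrite finite_setU; apply; split; apply: finite_image; apply: contrapT => inf.
    by apply: nA; exists YA.
  by apply: nB; exists YB.
- move=> [_ lam_inf] _ nA nB _ _.
  move=> [Y [YP /(gluing_antichain YP)[YA [YB [-> [YAP aA] [YBP aB]]]]]].
  move=> /(card_geU lam_inf)[lamY|lamY].
    by apply: nA; exists YA; split=> //; exact: card_le_trans lamY (leImA YA).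
  by apply: nB; exists YB; split=> //; exact: card_le_trans lamY (leImB YB).
(* Inclusion-exclusion: the residue [m] is counted twice and subtracted once. *)
- move=> _ _ [kA Ak] [kB Bk] [kC Ck] _; exists (kA + kB - kC).
  have eAk : eA @` PA #= PA by apply: inj_card_eq => x y _ _ /eAI.
  have eBk : eB @` PB #= PB by apply: inj_card_eq => x y _ _ /eBI.
  have eCk : (eA \o jA) @` PC #= PC by apply: inj_card_eq => x y _ _ /eAI/jAI.
  (* Needed to rearrange truncated subtractions. The products are compared, as [kC <= kA] may fail
     when [n = 0]. *)
  have CA : kC * n + m <= kA * n + m.
    rewrite -card_le_II -(card_le_eqr Ak) -(card_le_eql Ck) -(card_le_eqr eAk).
    rewrite -(card_le_eql eCk).
    by apply: subset_card_le; rewrite -gluing_setI.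
  have -> : (kA + kB - kC) * n + m = (kA * n + m) + (kB * n + m) - (kC * n + m).
    rewrite leq_add2r in CA.
    rewrite addnA subnDr mulnBl mulnDl addnBAC 1?addnAC //.
    exact: leq_trans CA (leq_addr _ _).
  rewrite gluing_setU; apply: card_II_setU; rewrite ?gluing_setI.
  + exact: card_eq_trans eAk Ak.
  + exact: card_eq_trans eBk Bk.
  + exact: card_eq_trans eCk Ck.
- move=> _ _ jnA jnB _ /(_ isT) C0; apply: gluing_joined C0 jnA jnB => x y [s [m [n xy]]];
    exists s, m, n; by [exact: edgeA|exact: edgeB].
- move=> _ _ jnA jnB _ /(_ isT) C0; apply: gluing_joined C0 jnA jnB => x y [m [n xy]];
    exists m, n; by [exact: edgeA|exact: edgeB].
- move=> _ _ jnA jnB _ /(_ isT) C0; apply: gluing_joined C0 jnA jnB => x y [k Rk xy];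
    exists k => //; by [exact: edgeA|exact: edgeB].
Qed.

End GluingConditions.

(** * Sentences in glued structures *)

Lemma comp_vcons X Y (e : X -> Y) n x (v : 'I_n -> X) :
  e \o vcons x v = vcons (e x) (e \o v).
Proof. by apply/funext => i; rewrite /vcons /=; case: unlift. Qed.

Lemma vcons0 X n x (v : 'I_n -> X) (lt0 : 0 < n.+1) : vcons x v (Ordinal lt0) = x.
Proof. by rewrite /vcons (_ : Ordinal lt0 = ord0) ?unlift_none //; exact: val_inj. Qed.

Lemma vconsS X n x (v : 'I_n -> X) k (ltk : k.+1 < n.+1) :
  vcons x v (Ordinal ltk) = v (Ordinal (ltk : k < n)).
Proof.
rewrite /vcons (_ : Ordinal ltk = lift ord0 (Ordinal (ltk : k < n))) ?liftK //.
exact: val_inj.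
Qed.

Lemma no_var_unique X (v : 'I_0 -> X) : v = @no_var X.
Proof. by apply/funext => -[]. Qed.

Section SentencesEmbedding.
Variables (L : language) (X Y : Type) (M : structure L X) (N : structure L Y).
Variables (e : X -> Y) (eP : embedding M N e).

Lemma eval_embedding n (v : 'I_n -> X) (t : term L n) :
  e (eval M v t) = eval N (e \o v) t.
Proof.
have [_ ef _] := eP; elim: t => //= f t IH.
by rewrite ef; congr fint; apply/funext => i; exact: IH.
Qed.

Lemma sat_embedding n (p : formula L n) (v : 'I_n -> X) :
  quantifier_free p -> sat M p v <-> sat N p (e \o v).
Proof.
have [einj _ eR] := eP.
elim: p v => //= {n}[n s t|n r t|n p IHp|n p IHp q IHq|n p IHp q IHq|n p IHp q IHq] v.
- by move=> _; rewrite -!eval_embedding; split=> [->|/einj].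
- move=> _; rewrite eR.
  rewrite (_ : (fun _ => _) = (fun j => eval N (e \o v) (t j))) //.
  by apply/funext => j; rewrite eval_embedding.
- by move=> /IHp ->.
- by move=> /andP[/IHp -> /IHq ->].
- by move=> /andP[/IHp -> /IHq ->].
- by move=> /andP[/IHp -> /IHq ->].
Qed.

Lemma sat_exists_block_embedding k n (p : formula L (k + n)) (v : 'I_n -> X) :
  (forall w, sat M p w -> sat N p (e \o w)) ->
  sat M (exists_block p) v -> sat N (exists_block p) (e \o v).
Proof.
elim: k p => [|k IHk] p pP /=; first exact: pP.
by apply: IHk => w /= [x px]; exists (e x); rewrite -comp_vcons; exact: pP.
Qed.

End SentencesEmbedding.

(** Once the universal element is located in A or in B, the existential witnesses found there are
    carried along the embedding, under which the quantifier-free matrix is invariant. *)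
Lemma simple_sentence_cover L XA XB XD (MA : structure L XA) (MB : structure L XB)
    (MD : structure L XD) eA eB (p : formula L 0) :
  embedding MA MD eA -> embedding MB MD eB ->
  (forall d, range eA d \/ range eB d) ->
  simple_sentence p -> models MA p -> models MB p -> models MD p.
Proof.
move=> eAP eBP cov; rewrite /models.
have no_varE X Y (e : X -> Y) : @no_var Y = e \o @no_var X.
  by apply/esym/no_var_unique.
have exA k n (q : formula L (k + n)) (v : 'I_n -> XA) : quantifier_free q ->
    sat MA (exists_block q) v -> sat MD (exists_block q) (eA \o v).
  by move=> qf; apply: sat_exists_block_embedding => // w; apply (sat_embedding eAP).
have exB k n (q : formula L (k + n)) (v : 'I_n -> XB) : quantifier_free q ->
    sat MB (exists_block q) v -> sat MD (exists_block q) (eB \o v).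
  by move=> qf; apply: sat_exists_block_embedding => // w; apply (sat_embedding eBP).
case=> [k q qf|q qf|k q qf] /=.
- move=> Aq Bq d; have [[a _ <-]|[b _ <-]] := cov d.
    by rewrite (no_varE _ _ eA) -comp_vcons; apply: (exA k.+1) => //; exact: Aq.
  by rewrite (no_varE _ _ eB) -comp_vcons; apply: (exB k.+1) => //; exact: Bq.
- move=> Aq Bq d; have [[a _ <-]|[b _ <-]] := cov d.
    by rewrite (no_varE _ _ eA) -comp_vcons; apply/(sat_embedding eAP).
  by rewrite (no_varE _ _ eB) -comp_vcons; apply/(sat_embedding eBP).
- by move=> Aq _; rewrite (no_varE _ _ eA); exact: (exA k.+1).
Qed.

(** * Reducts to the base language *)

Section Reduct.
Variables (L E : language).

Definition reduct X (M : structure (expansion L E) X) : structure L X :=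
  @Structure L X (fun f t => @fint _ _ M (inl f) t) (fun r t => @rint _ _ M (inl r) t).

Lemma eval_lift X (M : structure (expansion L E) X) n (v : 'I_n -> X) (t : term L n) :
  eval M v (lift_term E t) = eval (reduct M) v t.
Proof. by elim: t => //= f t IH; congr fint; apply/funext => i; exact: IH. Qed.

Lemma sat_lift X (M : structure (expansion L E) X) n (p : formula L n) v :
  sat M (lift_formula E p) v <-> sat (reduct M) p v.
Proof.
elim: p v => /= {n}[n s t|n r t|n p IHp|n p IHp q IHq|n p IHp q IHq
  |n p IHp q IHq|n p IHp|n p IHp] v.
- by rewrite !eval_lift.
- rewrite (_ : (fun j => eval M v _) = (fun j => eval (reduct M) v (t j))) //.
  by apply/funext => j; exact: eval_lift.
- by rewrite IHp.
- by rewrite IHp IHq.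
- by rewrite IHp IHq.
- by rewrite IHp IHq.
- by split=> pP x; apply/IHp.
- by split=> -[x px]; exists x; apply/IHp.
Qed.

Lemma Mod_lift (T : theory L) X (M : structure (expansion L E) X) :
  Mod (lift_theory E T) M <-> Mod T (reduct M).
Proof.
split=> [MT p Tp|MT _ [p Tp <-]]; apply/sat_lift; last exact: MT.
by apply: MT; exists p.
Qed.

Lemma reduct_embedding X Y (M : structure (expansion L E) X) N (e : X -> Y) :
  embedding M N e -> embedding (reduct M) (reduct N) e.
Proof. by case=> einj ef eR; split=> // [f|r]; [exact: (ef (inl f))|exact: (eR (inl r))]. Qed.

End Reduct.

(** * Semantic reading of the axioms *)

Section AxiomMeaning.
Variables (I H : Type) (X : Type) (M : structure (base_language I H) X).
Implicit Types (i j : rsym (base_language I H)) (h : H).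

Definition fun1 h (x : X) : X := @fint (base_language I H) X M h (fun=> x).

Lemma eval_pair n i (s t : term (base_language I H) n) v :
  rint M (r := i) (fun j : 'I_2 => eval M v (pair_args s t j)) =
  bin M i (eval M v s) (eval M v t).
Proof. by rewrite /bin -(pair_args_map _ (eval M v)). Qed.

Ltac read_axiom :=
  rewrite /= ?eval_pair /= !(vconsS, vcons0); rewrite -/(fun1 _ _); tauto.

Lemma models_transitive i : models M (ax_transitive H i) <->
  forall x y z, bin M i x y -> bin M i y z -> bin M i x z.
Proof. by split=> ax x y z; have := ax x y z; read_axiom. Qed.

Lemma models_reflexive i : models M (ax_reflexive H i) <-> forall x, bin M i x x.
Proof. by split=> ax x; have := ax x; read_axiom. Qed.

Lemma models_symmetric i : models M (ax_symmetric H i) <->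
  forall x y, bin M i x y -> bin M i y x.
Proof. by split=> ax x y; have := ax x y; read_axiom. Qed.

Lemma models_antireflexive i : models M (ax_antireflexive H i) <->
  forall x, ~ bin M i x x.
Proof. by split=> ax x; have := ax x; read_axiom. Qed.

Lemma models_antisymmetric i : models M (ax_antisymmetric H i) <->
  forall x y, bin M i x y -> bin M i y x -> x = y.
Proof. by split=> ax x y; have := ax x y; read_axiom. Qed.

Lemma models_preserves h i : models M (ax_preserves h i) <->
  forall x y, bin M i x y -> bin M i (fun1 h x) (fun1 h y).
Proof. by split=> ax x y; have := ax x y; read_axiom. Qed.

Lemma models_reverses h i : models M (ax_reverses h i) <->
  forall x y, bin M i x y -> bin M i (fun1 h y) (fun1 h x).
Proof. by split=> ax x y; have := ax x y; read_axiom. Qed.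

Lemma models_coarser i j : models M (ax_coarser H i j) <->
  forall x y, bin M j x y -> bin M i x y.
Proof. by split=> ax x y; have := ax x y; read_axiom. Qed.

Lemma models_strictly_preserves h i : models M (ax_strictly_preserves h i) <->
  forall x y, strict (bin M i) x y -> strict (bin M i) (fun1 h x) (fun1 h y).
Proof. by rewrite /strict; split=> ax x y; have := ax x y; read_axiom. Qed.

Lemma models_strictly_reverses h i : models M (ax_strictly_reverses h i) <->
  forall x y, strict (bin M i) x y -> strict (bin M i) (fun1 h y) (fun1 h x).
Proof.
(* The axiom and [strict] state the disequality in opposite orders, hence the extra [esym]. *)
rewrite /strict; split=> ax x y; have := ax x y.
  rewrite /= ?eval_pair /= !(vconsS, vcons0) -/(fun1 _ _) => {}ax /ax[r ne].
  by split=> // /esym.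
move=> {}ax; rewrite /= ?eval_pair /= !(vconsS, vcons0) -/(fun1 _ _) => /ax[r ne].
by split=> // /esym.
Qed.

End AxiomMeaning.

(** * Preservation of the axioms of T *)

Section GluingAdmissible.
Variables (I H : Type).
Notation L := (base_language I H).
Variables (XA XB XC XD : Type).
Variables (MA : structure L XA) (MB : structure L XB) (MC : structure L XC).
Variables (MD : structure L XD).
Variables (jA : XC -> XA) (jB : XC -> XB) (eA : XA -> XD) (eB : XB -> XD).
Hypothesis glued : gluing MA MB MC MD jA jB eA eB.
Hypothesis free : forall i : I, freely_glued_rel MA MB MD eA eB (i : rsym L).

Lemma push_fun1 X (M : structure L X) (e : X -> XD) (R S : X -> X -> Prop) h :
  embedding M MD e -> (forall x y, R x y -> S (fun1 M h x) (fun1 M h y)) ->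
  forall x y, push e R x y -> push e S (fun1 MD h x) (fun1 MD h y).
Proof.
move=> [_ ef _] fR _ _ [u [v [<- <- /fR uv]]].
by exists (fun1 M h u), (fun1 M h v); split=> //; rewrite /fun1 ef.
Qed.

Lemma push_flip_fun1 X (M : structure L X) (e : X -> XD) (R S : X -> X -> Prop) h :
  embedding M MD e -> (forall x y, R x y -> S (fun1 M h y) (fun1 M h x)) ->
  forall x y, push e R x y -> push e S (fun1 MD h y) (fun1 MD h x).
Proof.
move=> [_ ef _] fR _ _ [u [v [<- <- /fR uv]]].
by exists (fun1 M h v), (fun1 M h u); split=> //; rewrite /fun1 ef.
Qed.

Lemma Mod_gluing (T : theory L) : admissible_theory T ->
  Mod T MA -> Mod T MB -> Mod T MD.
Proof.
move=> [Ttr Tadm] TA TB p Tp.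
have [jAP jBP] := (gluing_jA glued, gluing_jB glued).
have [eAP eBP] := (gluing_eA glued, gluing_eB glued).
have [[eAI _ _] [eBI _ _]] := (eAP, eBP).
have cov := gluing_cover glued.
pose RA (i : rsym L) := push eA (bin MA i); pose RB (i : rsym L) := push eB (bin MB i).
have binD i : bin MD i = amalgam_rel (RA i) (RB i).
  by apply/funext => x; apply/funext => y; apply/propext; exact: free.
have RAP i := @push_supported _ _ eA (bin MA i).
have RBP i := @push_supported _ _ eB (bin MB i).
have RAB (i : rsym L) : agree_on (range eA `&` range eB) (RA i) (RB i).
  exact: push_agree jAP jBP eAI eBI (gluing_comm glued) (gluing_pullback glued) _.
have RAtr (i : rsym L) : forall x y z, RA i x y -> RA i y z -> RA i x z.
  by apply: push_trans => //; apply/models_transitive/Ttr.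
have RBtr (i : rsym L) : forall x y z, RB i x y -> RB i y z -> RB i x z.
  by apply: push_trans => //; apply/models_transitive/Ttr.
have RAanti (i : rsym L) : models MA (ax_antisymmetric H i) ->
    forall x y, RA i x y -> RA i y x -> x = y.
  by move=> /models_antisymmetric; exact: push_antisym.
have RBanti (i : rsym L) : models MB (ax_antisymmetric H i) ->
    forall x y, RB i x y -> RB i y x -> x = y.
  by move=> /models_antisymmetric; exact: push_antisym.
move: (TA _ Tp) (TB _ Tp).
case: (Tadm _ Tp) => {p Tp}[i|i|i|i|i|h i|h i|i j|p sp|h i [_ _ Tanti]|h i [_ _ Tanti]].
- by move=> _ _; apply/models_transitive; rewrite binD;
    exact: (amalgam_rel_trans (RAP i) (RBP i) (RAB i) (RAtr i) (RBtr i)).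
- move=> /models_reflexive Arefl /models_reflexive Brefl; apply/models_reflexive => x.
  rewrite binD; have [[a _ <-]|[b _ <-]] := cov x; [constructor 1|constructor 2].
    by exists a, a.
  by exists b, b.
- move=> /models_symmetric Asym /models_symmetric Bsym; apply/models_symmetric => x y.
  rewrite binD => xy; apply/amalgam_rel_flip; apply: amalgam_rel_sub xy
    => u v [u' [v' [<- <- uv]]].
    by exists v', u'; split=> //; exact: Asym.
  by exists v', u'; split=> //; exact: Bsym.
- move=> /models_antireflexive Airr /models_antireflexive Birr; apply/models_antireflexive.
  rewrite binD; apply: (amalgam_rel_irrefl (RAP i) (RBP i) (RAB i) (RAtr i)) => //.
    by move=> _ [u [v [<- /eAI -> /Airr]]].
  by move=> _ [u [v [<- /eBI -> /Birr]]].
- move=> /RAanti Aanti /RBanti Banti; apply/models_antisymmetric.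
  by rewrite binD; exact: (amalgam_rel_antisym (RAP i) (RBP i) (RAB i) (RAtr i) (RBtr i)).
- move=> /models_preserves Af /models_preserves Bf; apply/models_preserves.
  by rewrite binD; apply: amalgam_rel_homo; [apply: push_fun1 eAP _|apply: push_fun1 eBP _].
- move=> /models_reverses Af /models_reverses Bf; apply/models_reverses => x y.
  rewrite binD => xy; apply/amalgam_rel_flip; apply: amalgam_rel_homo xy.
    exact: push_flip_fun1 eAP Af.
  exact: push_flip_fun1 eBP Bf.
- move=> /models_coarser Aji /models_coarser Bji; apply/models_coarser.
  by rewrite !binD; apply: amalgam_rel_sub; exact: push_coarser.
- exact: (simple_sentence_cover eAP eBP cov sp).
- move=> /models_strictly_preserves Af /models_strictly_preserves Bf.
  apply/models_strictly_preserves; rewrite binD.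
  (* [Tanti] is read in A and in B; it lets the strict parts amalgamate. *)
  apply: (amalgam_rel_strict_homo (RAP i) (RBP i) (RAB i) (RAtr i) (RBtr i)) => //;
    [exact/RAanti/Tanti|exact/RBanti/Tanti|..].
    by move=> x y /(strict_push _ _ _ eAI) xy; apply/(strict_push _ _ _ eAI);
      exact: (push_fun1 eAP Af xy).
  by move=> x y /(strict_push _ _ _ eBI) xy; apply/(strict_push _ _ _ eBI);
      exact: (push_fun1 eBP Bf xy).
- move=> /models_strictly_reverses Af /models_strictly_reverses Bf.
  apply/models_strictly_reverses; rewrite binD.
  apply: (amalgam_rel_strict_antihomo (RAP i) (RBP i) (RAB i) (RAtr i) (RBtr i)) => //;
    [exact/RAanti/Tanti|exact/RBanti/Tanti|..].
    by move=> x y /(strict_push _ _ _ eAI) xy; apply/(strict_push _ _ _ eAI);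
      exact: (push_flip_fun1 eAP Af xy).
  by move=> x y /(strict_push _ _ _ eBI) xy; apply/(strict_push _ _ _ eBI);
      exact: (push_flip_fun1 eBP Bf xy).
Qed.

End GluingAdmissible.

(** * Amalgamation in classes of structures *)

Definition incl U (P Q : set U) (PQ : P `<=` Q) (x : P) : Q :=
  SigSub (mem_set (PQ _ (set_valP x))).

Section AmalgamationClass.
Variables (L : language) (K : class L) (Q : set (rsym L)).
Hypothesis Q2 : forall r, Q r -> rarity r = 2.
Hypothesis Ktr : forall X (M : structure L X) r, K M -> Q r ->
  forall x y z, bin M r x y -> bin M r y z -> bin M r x z.
Hypothesis Kglue : forall XA XB XC XD (MA : structure L XA) (MB : structure L XB)
    (MC : structure L XC) (MD : structure L XD) jA jB eA eB,
  gluing MA MB MC MD jA jB eA eB ->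
  (forall r, Q r -> freely_glued_rel MA MB MD eA eB r) ->
  K MA -> K MB -> K MD.

(** All four maps are inclusions inside [U], as their [set_val] equations record. The class is
    accessed through [Ktr] and [Kglue], so the models of [T] and those in an expanded language share
    one argument. *)
Lemma amalgam_exists U (A B C : structure_in L U) :
  mem_class K A -> mem_class K B ->
  substructure C A -> substructure C B -> dom C = dom A `&` dom B ->
  exists (D : structure_in L U) (jA : dom C -> dom A) (jB : dom C -> dom B)
      (eA : dom A -> dom D) (eB : dom B -> dom D),
    [/\ mem_class K D /\ amalgam A B D,
        [/\ forall c, set_val (jA c) = set_val c, forall a, set_val (eA a) = set_val a
          & forall b, set_val (eB b) = set_val b],
        gluing A B C D jA jB eA eB, projecting D eA eB
      & forall r, Q r -> freely_glued_rel A B D eA eB r].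
Proof.
move=> KA KB [jA [jAv jAP]] [jB [jBv jBP]] CAB.
pose eA : dom A -> (dom A `|` dom B : set U) := incl (@subsetUl _ _ _).
pose eB : dom B -> (dom A `|` dom B : set U) := incl (@subsetUr _ _ _).
have eAI : injective eA by move=> x y /(congr1 set_val) /= e; apply: val_inj.
have eBI : injective eB by move=> x y /(congr1 set_val) /= e; apply: val_inj.
have comm c : eA (jA c) = eB (jB c).
  by apply: val_inj; rewrite /= [LHS]jAv [RHS]jBv.
have pb a b : eA a = eB b -> exists2 c, a = jA c & b = jB c.
  move=> /(congr1 set_val) e; have {}e : set_val a = set_val b := e.
  have Ca : dom C (set_val a).
    by rewrite CAB; split; [exact: set_valP|rewrite e; exact: set_valP].
  exists (SigSub (mem_set Ca)); apply/val_inj/esym; first exact: jAv.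
  exact: (etrans (jBv (SigSub (mem_set Ca))) e).
have cov d : range eA d \/ range eB d.
  have [Ad|Bd] := set_valP d; [left; exists (SigSub (mem_set Ad))|
    right; exists (SigSub (mem_set Bd))] => //; exact: val_inj.
have [MD [G proj free]] := gluing_exists jAP jBP eAI eBI comm pb cov Q2
  (fun r => @Ktr _ _ r KA) (fun r => @Ktr _ _ r KB).
exists (StructureIn MD), jA, jB, eA, eB; split=> //; split.
  exact: Kglue G free KA KB.
split=> //; [exists eA|exists eB]; split=> //; [exact: gluing_eA G|exact: gluing_eB G].
Qed.

Lemma class_SAPU : SAPU K.
Proof.
move=> U A B C KA KB _ CA CB CAB _.
have [D [_ [_ [_ [_ [[KD ABD] _ _ _ _]]]]]] := amalgam_exists KA KB CA CB CAB.
by exists D.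
Qed.

(** A single step, or a composite in the wrong order, would put [a] in B or [b] in A. In the
    remaining composite the midpoint comes from both sides, hence from C by the pullback
    property. *)
Lemma class_superSAPU r : Q r -> superSAPU K r.
Proof.
move=> Qr U A B C KA KB _ CA CB CAB.
have [D [jA [jB [eA [eB [[KD ABD] [jAv eAv eBv] G _ free]]]]]] :=
  amalgam_exists KA KB CA CB CAB.
exists D; split=> // a b [Aa nBa] [Bb nAb].
have via_C x y z : eA x = z -> eB y = z -> exists2 c, x = jA c & y = jB c.
  by move=> xz yz; apply: (gluing_pullback G); rewrite xz yz.
have dA x : dom A (set_val (eA x)) by rewrite eAv; exact: set_valP.
have dB x : dom B (set_val (eB x)) by rewrite eBv; exact: set_valP.
split=> -[x [y [xa yb /(free r Qr)]]].
  case=> [[u [v [_ vy _]]]|[u [v [ux _ _]]]|[z [u [v [ux vz uv]]] [v' [w [v'z wy vw]]]]|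
      [z [u [v [ux _ _]]] _]].
  - by case: nAb; rewrite -yb -vy.
  - by case: nBa; rewrite -xa -ux.
  - have [c vc v'c] := via_C _ _ _ vz v'z.
    exists (set_val c); split; first exact: set_valP.
      by exists u, v; split=> //; [rewrite -xa -ux eAv|rewrite vc jAv].
    exists v', w; split=> //; last by rewrite -yb -wy eBv.
    by rewrite -eBv v'z -vz eAv vc jAv.
  - by case: nBa; rewrite -xa -ux.
case=> [[u [v [ux _ _]]]|[u [v [_ vy _]]]|[z [u [v [ux _ _]]] _]|
    [z [u [v [ux vz uv]]] [v' [w [v'z wy vw]]]]].
- by case: nAb; rewrite -xa -ux.
- by case: nBa; rewrite -yb -vy.
- by case: nAb; rewrite -xa -ux.
- have [c v'c vc] := via_C _ _ _ v'z vz.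
  exists (set_val c); split; first exact: set_valP.
    exists u, v; split=> //; first by rewrite -xa -ux eBv.
    by rewrite -eBv vz -v'z eAv v'c jAv.
  by exists v', w; split=> //; [rewrite v'c jAv|rewrite -yb -wy eAv].
Qed.

Lemma extent_embedding X Y (M : structure L X) (N : structure L Y) e V x :
  embedding M N e -> extent N V (e x) <-> extent M V x.
Proof. by move=> [_ _ eR]; apply: iff_sym; exact: (eR V (fun=> x)). Qed.

Lemma class_subclasses_SAPU : subclasses_SAPU K.
Proof.
move=> S Slegit U A B C [KA SA] [KB SB] [KC SC] CA CB CAB bot.
have [D [jA [jB [eA [eB [[KD ABD] _ G proj _]]]]]] := amalgam_exists KA KB CA CB CAB.
exists D; split=> //; split=> // c Sc.
move: (Slegit _ Sc) (SA _ Sc) (SB _ Sc) (SC _ Sc) (bot _ Sc).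
case: c {Sc} => [c legit Ac Bc Cc Cbot|V c [_ legit] Ac Bc Cc Cbot] /=.
  exact: (holds_on_gluing G proj) legit KD Ac Bc Cc Cbot.
apply: (holds_on_gluing G proj) legit KD Ac Bc Cc Cbot => x; apply: extent_embedding.
- exact: gluing_eA G.
- exact: gluing_eB G.
- exact: gluing_jA G.
Qed.

End AmalgamationClass.

Theorem theorem4p10 (I H : Type) (T : theory (base_language I H))
    (hT : admissible_theory T) :
  [/\ SAPU (Mod T),
      forall i : I, superSAPU (Mod T) (i : rsym (base_language I H)),
      subclasses_SAPU (Mod T)
    & forall (E : language) (Sigma' : theory (expansion (base_language I H) E)),
        (forall p, Sigma' p -> simple_sentence p) ->
        let K := Mod (lift_theory E T `|` Sigma') in
        [/\ SAPU K,
            forall i : I,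
              superSAPU K (inl i : rsym (expansion (base_language I H) E))
          & subclasses_SAPU K]].
Proof.
have [Ttr _] := hT.
pose Q : set (rsym (base_language I H)) := setT.
have Q2 r : Q r -> rarity r = 2 by [].
have Mtr X (M : structure (base_language I H) X) r : Mod T M -> Q r ->
    forall x y z, bin M r x y -> bin M r y z -> bin M r x z.
  by move=> TM _; apply/models_transitive/Ttr.
have Mglue XA XB XC XD (MA : structure _ XA) (MB : structure _ XB)
    (MC : structure _ XC) (MD : structure _ XD) jA jB eA eB :
    gluing MA MB MC MD jA jB eA eB ->
    (forall r, Q r -> freely_glued_rel MA MB MD eA eB r) ->
    Mod T MA -> Mod T MB -> Mod T MD.
  by move=> G free TA TB; apply: (Mod_gluing G _ hT) => // i; exact: free.
split; [exact: class_SAPU Q2 Mtr Mglue| |exact: class_subclasses_SAPU Q2 Mtr Mglue|].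
  by move=> i; apply: (class_superSAPU Q2 Mtr Mglue).
move=> E Sigma' Ssimple K; set LE := expansion (base_language I H) E in Sigma' Ssimple K *.
(* Only the symbols of the base language receive composites; those of [E] are merely united. *)
pose QE : set (rsym LE) := range inl.
have QE2 r : QE r -> rarity r = 2 by move=> [i _ <-].
have KT X (M : structure LE X) : K X M -> Mod T (reduct M).
  by move=> KM; apply/Mod_lift => p Tp; apply: KM; left.
have Ktr X (M : structure LE X) r : K X M -> QE r ->
    forall x y z, bin M r x y -> bin M r y z -> bin M r x z.
  by move=> /KT TM [i _ <-]; exact: (Mtr X (reduct M) i TM Logic.I).
have Kglue XA XB XC XD (MA : structure LE XA) (MB : structure LE XB)
    (MC : structure LE XC) (MD : structure LE XD) jA jB eA eB :
    gluing MA MB MC MD jA jB eA eB ->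
    (forall r, QE r -> freely_glued_rel MA MB MD eA eB r) ->
    K XA MA -> K XB MB -> K XD MD.
  (* The axioms of [T] are checked in the reducts, which still form a gluing; the sentences of
     [Sigma'] are checked in the full language. *)
  move=> G free KA KB p [].
    apply/Mod_lift: p.
    apply: (Mglue _ _ _ _ _ _ (reduct MC) _ jA jB eA eB) (KT _ _ KA) (KT _ _ KB).
      case: G => *; split=> //; exact: reduct_embedding.
    by move=> i _; apply: (free (inl i)); exists i.
  move=> Sp; have [_ _ eAP eBP _ _ cov] := G.
  by apply: (simple_sentence_cover eAP eBP cov) (Ssimple _ Sp) _ _;
    [apply: KA; right|apply: KB; right].
split; [exact: class_SAPU QE2 Ktr Kglue| |exact: class_subclasses_SAPU QE2 Ktr Kglue].
by move=> i; apply: (class_superSAPU QE2 Ktr Kglue); exists i.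
Qed.
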